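(* Let $n\ge 59$ be an integer and let $G$ be a simple graph. Then $G\in\mathcal{G}(n,n-3)$ if and only if $G\cong H_1(n)$ when $n$ is even, and $G\cong H_2(n)$ when $n$ is odd.
   Context: All graphs are finite and simple. The spectral radius of a graph is the largest eigenvalue of its adjacency matrix. A graph is nonregular if not all its vertices have the same degree. For integers $n$ and $\Delta$, $\mathcal{G}(n,\Delta)$ denotes the set of connected nonregular graphs of order $n$ with maximum degree $\Delta$ whose spectral radius is maximum among all connected nonregular graphs of order $n$ with maximum degree $\Delta$. For an even integer $t$, $K_t-M_{t/2}$ denotes the graph obtained from the complete graph $K_t$ by deleting the edges of a perfect matching. For even $n$, $H_1(n)$ is the graph of order $n$ whose vertex set is partitioned as $\{u,v\}\cup V_1\cup V_2$ with $|V_1|=n-4$, $|V_2|=2$, whose edges are exactly: the edge $uv$; the edges of a copy of $K_{n-4}-M_{(n-4)/2}$ on $V_1$; the edge joining the two vertices of $V_2$; all edges between $v$ and $V_1$; and all edges between $V_1$ and $V_2$. For odd $n$, $H_2(n)$ is the graph of order $n$ whose vertex set is partitioned as $\{u,v_1,v_2\}\cup V_1\cup V_2\cup V_3$ with $|V_1|=|V_2|=2$ and $|V_3|=n-7$, whose edges are exactly: the three edges among $u,v_1,v_2$ (a triangle); all edges within $V_1\cup V_2$ (a $K_4$); the edges of a copy of $K_{n-7}-M_{(n-7)/2}$ on $V_3$; all edges between each vertex of $V_3$ and each vertex of $\{v_1,v_2\}\cup V_1\cup V_2$; the edges from $v_1$ to both vertices of $V_1$; and the edges from $v_2$ to both vertices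 of $V_2$. *)

(* Defs.v *)
From HB Require Import structures.
From mathcomp Require Import all_boot all_order all_algebra.
From mathcomp Require Import reals.
Set Implicit Arguments.
Unset Strict Implicit.
Unset Printing Implicit Defensive.
Import Order.TTheory GRing.Theory Num.Theory.
Local Open Scope ring_scope.

Record sgraph := SGraph {
  vertex :> finType;
  adj : rel vertex;
  adj_sym : symmetric adj;
  adj_irrefl : irreflexive adj
}.

Definition giso (G H : sgraph) : Prop :=
  exists2 f : G -> H, bijective f & forall x y : G, adj (f x) (f y) = adj x y.

Definition degree (G : sgraph) (x : G) : nat := #|[set y : G | adj x y]|.

Definition max_degree (G : sgraph) : nat := (\max_(x : G) degree x)%N.

Definition regular (G : sgraph) : Prop := forall x y : G, degree x = degree y.

Definition connected (G : sgraph) : Prop :=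
  (0 < #|G|)%N /\ forall x y : G, connect (@adj G) x y.

Definition adjmx (R : realType) (G : sgraph) : 'M[R]_#|G| :=
  \matrix_(i, j) (adj (enum_val i) (enum_val j))%:R.

Definition is_spectral_radius (R : realType) (G : sgraph) (rho : R) : Prop :=
  eigenvalue (adjmx R G) rho /\
  forall a : R, eigenvalue (adjmx R G) a -> a <= rho.

Definition nonregular_class (n Delta : nat) (G : sgraph) : Prop :=
  [/\ #|G| = n, connected G, ~ regular G & max_degree G = Delta].

Definition extremal (R : realType) (n Delta : nat) (G : sgraph) : Prop :=
  nonregular_class n Delta G /\
  exists2 rho : R, is_spectral_radius G rho &
    forall (H : sgraph) (rho' : R),
      nonregular_class n Delta H -> is_spectral_radius H rho' -> rho' <= rho.

(* K_t - M_{t/2} for even t: the deleted perfect matching consists of the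
   pairs {2k, 2k+1}. *)
Definition cocktail_adj (t : nat) : rel 'I_t :=
  fun i j => (i != j) && (i./2 != j./2)%N.

Inductive H1_vertex (n : nat) : Type :=
  | H1_u | H1_v | H1_V1 of 'I_(n - 4) | H1_V2 of 'I_2.

Section H1Finite.
Variable n : nat.
Definition H1_code (x : H1_vertex n) : bool + ('I_(n - 4) + 'I_2) :=
  match x with
  | H1_u => inl true
  | H1_v => inl false
  | H1_V1 i => inr (inl i)
  | H1_V2 i => inr (inr i)
  end.
Definition H1_decode (c : bool + ('I_(n - 4) + 'I_2)) : H1_vertex n :=
  match c with
  | inl true => H1_u n
  | inl false => H1_v n
  | inr (inl i) => H1_V1 i
  | inr (inr i) => H1_V2 n i
  end.
Lemma H1_codeK : cancel H1_code H1_decode.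
Proof. by case. Qed.
HB.instance Definition _ := Finite.copy (H1_vertex n) (can_type H1_codeK).
End H1Finite.

Definition H1_adj (n : nat) : rel (H1_vertex n) :=
  fun x y => match x, y with
  | H1_u, H1_v | H1_v, H1_u => true
  | H1_V1 i, H1_V1 j => cocktail_adj i j
  | H1_V2 i, H1_V2 j => i != j
  | H1_v, H1_V1 _ | H1_V1 _, H1_v => true
  | H1_V1 _, H1_V2 _ | H1_V2 _, H1_V1 _ => true
  | _, _ => false
  end.

Lemma H1_adj_sym n : symmetric (@H1_adj n).
Proof. by move=> [||i|i] [||j|j] //=; rewrite /cocktail_adj eq_sym // (eq_sym i./2). Qed.

Lemma H1_adj_irrefl n : irreflexive (@H1_adj n).
Proof. by move=> [||i|i] //=; rewrite /cocktail_adj eqxx. Qed.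

(* H_1(n), meaningful for even n >= 4. *)
Definition H1 (n : nat) : sgraph := SGraph (@H1_adj_sym n) (@H1_adj_irrefl n).

(* [H2_v false], [H2_v true] are v_1, v_2, and [H2_W false i], [H2_W true i]
   are the vertices of V_1, V_2 respectively. *)
Inductive H2_vertex (n : nat) : Type :=
  | H2_u | H2_v of bool | H2_W of bool & 'I_2 | H2_V3 of 'I_(n - 7).

Section H2Finite.
Variable n : nat.
Definition H2_code (x : H2_vertex n) :
    (unit + bool) + ((bool * 'I_2) + 'I_(n - 7)) :=
  match x with
  | H2_u => inl (inl tt)
  | H2_v b => inl (inr b)
  | H2_W b i => inr (inl (b, i))
  | H2_V3 i => inr (inr i)
  end.
Definition H2_decode (c : (unit + bool) + ((bool * 'I_2) + 'I_(n - 7))) :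
    H2_vertex n :=
  match c with
  | inl (inl _) => H2_u n
  | inl (inr b) => H2_v n b
  | inr (inl (b, i)) => H2_W n b i
  | inr (inr i) => H2_V3 i
  end.
Lemma H2_codeK : cancel H2_code H2_decode.
Proof. by case. Qed.
HB.instance Definition _ := Finite.copy (H2_vertex n) (can_type H2_codeK).
End H2Finite.

Definition H2_adj (n : nat) : rel (H2_vertex n) :=
  fun x y => match x, y with
  | H2_u, H2_v _ | H2_v _, H2_u => true
  | H2_v b, H2_v c => b != c
  | H2_W b i, H2_W c j => (b, i) != (c, j)
  | H2_V3 i, H2_V3 j => cocktail_adj i j
  | H2_V3 _, H2_v _ | H2_v _, H2_V3 _ => true
  | H2_V3 _, H2_W _ _ | H2_W _ _, H2_V3 _ => true
  | H2_v b, H2_W c _ | H2_W c _, H2_v b => b == c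
  | _, _ => false
  end.

Lemma H2_adj_sym n : symmetric (@H2_adj n).
Proof.
by move=> [|b|b i|i] [|c|c j|j] //=; rewrite /cocktail_adj eq_sym // (eq_sym i./2).
Qed.

Lemma H2_adj_irrefl n : irreflexive (@H2_adj n).
Proof. by move=> [|b|b i|i] //=; rewrite /cocktail_adj eqxx. Qed.

(* H_2(n), meaningful for odd n >= 7. *)
Definition H2 (n : nat) : sgraph := SGraph (@H2_adj_sym n) (@H2_adj_irrefl n).

(* Main.v *)
Require Import Defs.
From mathcomp Require Import all_boot all_order all_algebra.
From mathcomp Require Import reals.
From mathcomp Require Import zify ring lra.
Set Implicit Arguments.
Unset Strict Implicit.
Unset Printing Implicit Defensive.
Import Order.TTheory GRing.Theory Num.Theory.
Local Open Scope ring_scope.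

(* Let M - 1 be the spectral radius of H1 or H2 and delta = n - 2 - M; then
   delta is the root of the characteristic equation of an equitable partition,
   and delta < 2/M - 8/M^2 + O(1/M^3).  By Collatz-Wielandt, any other graph is
   beaten once it carries a positive vector y with A y < (M - 1) y.  Delete a
   set L of at most two vertices of degree at most 3 and let K be the adjacency
   matrix of the complement of G - L.  Since A = J - I - K outside L, a
   suitable y is obtained there by truncating the Neumann series of
   (M + K)^-1 1, with the sign of the error term in our favour.  The row sums of
   K are 2 - |L| plus an excess f, and two terms of the series suffice as soon
   as the sum of f_i (M - (2 - |L|) - f_i) exceeds 2M - 7.5 by the (bounded)
   contribution of L.  The exceptions have total excess at most 2: excess 1 and
   2 next to a single vertex of L give H1, H2 and one competitor of H2 that
   agrees with it up to order 1/M^2, while excess 2 at a single vertex with L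
   empty needs four terms of the series. *)

(** * Adjacency eigenvalues and positive supersolutions *)

Section Eigenvalues.
Variables (R : realType) (G : sgraph).
Implicit Types (a r : R) (x y : G -> R).

Lemma eigenvalue_adjmxP a :
  reflect (exists2 x : G -> R, exists i, x i != 0
                    & forall i : G, \sum_(j | adj i j) x j = a * x i)
          (eigenvalue (adjmx R G) a).
Proof.
apply: (iffP eigenvalueP) => [[v vA v0]|[x [i0 xi0] xA]].
- exists (fun i => v 0 (enum_rank i)).
    have /rV0Pn[j vj] := v0.
    by exists (enum_val j); rewrite enum_valK.
  move=> i; have /rowP/(_ (enum_rank i)) := vA; rewrite !mxE => <-.
  rewrite (reindex (@enum_val G G)) /=; last exact/onW_bij/enum_val_bij.
  rewrite big_mkcond; apply: eq_bigr => j _.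
  by rewrite !mxE enum_valK enum_rankK adj_sym; case: adj; rewrite ?mulr1 ?mulr0.
- exists (\row_j x (enum_val j)); last first.
    by apply/rV0Pn; exists (enum_rank i0); rewrite mxE enum_rankK.
  apply/rowP => j; rewrite !mxE -xA (reindex (@enum_val G G)) /=; last first.
    exact/onW_bij/enum_val_bij.
  rewrite [RHS]big_mkcond; apply: eq_bigr => i _.
  by rewrite !mxE adj_sym; case: adj; rewrite ?mulr1 ?mulr0.
Qed.

Lemma adj_exchange x y :
  \sum_(i : G) y i * (\sum_(j | adj i j) x j) = \sum_j x j * (\sum_(i | adj j i) y i).
Proof.
transitivity (\sum_(i : G) \sum_(j : G) (adj i j)%:R * (y i * x j)).
  apply: eq_bigr => i _; rewrite mulr_sumr big_mkcond /=; apply: eq_bigr => j _.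
  by case: adj; rewrite ?mul1r ?mul0r.
rewrite exchange_big /=; apply/eq_bigr => j _.
rewrite mulr_sumr [RHS]big_mkcond /=; apply: eq_bigr => i _.
by rewrite adj_sym; case: adj; rewrite ?mul1r ?mul0r // mulrC.
Qed.

(* Pair the strict supersolution [y] with the absolute value of an eigenvector. *)
Lemma supersolution_not_eigenvalue a y :
  (forall i, 0 < y i) -> (forall i : G, \sum_(j | adj i j) y j < a * y i) ->
  ~~ eigenvalue (adjmx R G) a.
Proof.
move=> y0 Ay; apply/negP => /eigenvalue_adjmxP[x [i0 xi0] xA].
have xle i : a * `|x i| <= \sum_(j | adj i j) `|x j|.
  apply: (@le_trans _ _ `|a * x i|); first by rewrite normrM ler_wpM2r ?ler_norm.
  by rewrite -xA ler_norm_sum.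
have : \sum_i y i * (a * `|x i|) <= \sum_i y i * \sum_(j | adj i j) `|x j|.
  by apply: ler_sum => i _; rewrite ler_wpM2l // ltW.
rewrite adj_exchange => h.
have : \sum_j `|x j| * \sum_(i | adj j i) y i < \sum_j `|x j| * (a * y j).
  rewrite (bigD1 i0) //= [ltRHS](bigD1 i0) //= ltr_leD //.
    by rewrite ltr_pM2l ?normr_gt0.
  by apply: ler_sum => j _; rewrite ler_wpM2l // ltW.
move/(le_lt_trans h); rewrite (eq_bigr (fun j => `|x j| * (a * y j))) ?ltxx //.
by move=> i _; ring.
Qed.

(** A positive supersolution for [r] is one for every larger number as well, so no eigenvalue can
    reach [r]. *)
Lemma supersolution_gt_eigenvalue r y :
  (forall i, 0 < y i) -> (forall i : G, \sum_(j | adj i j) y j < r * y i) ->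
  forall a, eigenvalue (adjmx R G) a -> a < r.
Proof.
move=> y0 Ay a; apply: contraLR; rewrite -leNgt => ra.
apply: (supersolution_not_eigenvalue y0) => i.
by apply: (lt_le_trans (Ay i)); rewrite ler_wpM2r // ltW.
Qed.

(** The easy half of Perron-Frobenius: for any [a] above [r] the positive eigenvector is itself a
    strict supersolution. The vertex [i0] makes it nonzero. *)
Lemma positive_eigenvector_spectral_radius r y (i0 : G) :
  (forall i, 0 < y i) -> (forall i : G, \sum_(j | adj i j) y j = r * y i) ->
  is_spectral_radius G r.
Proof.
move=> y0 Ay; split.
  by apply/eigenvalue_adjmxP; exists y => //; exists i0; rewrite gt_eqF.
move=> a; apply: contraLR; rewrite -ltNge => ra.
apply: (supersolution_not_eigenvalue y0) => i.
by rewrite Ay ltr_pM2r.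
Qed.

End Eigenvalues.

(** * Listing a perfect matching by consecutive pairs *)

Section MatchingEnum.
Variable T : finType.
Implicit Types (e : rel T) (S : {set T}).

(** Removing one matched pair at a time puts partners at positions [2k] and [2k+1], the very pairs
    deleted in [cocktail_adj]. *)
Lemma matching_enum e S :
  symmetric e -> irreflexive e ->
  (forall x, x \in S -> exists2 y, y \in S & forall z, z \in S -> e x z = (z == y)) ->
  exists s : seq T, [/\ uniq s, s =i S, ~~ odd (size s) &
    forall x0 i j, (i < size s)%N -> (j < size s)%N ->
      e (nth x0 s i) (nth x0 s j) = (i != j) && (i./2 == j./2)%N].
Proof.
move=> es ei; have [m] := ubnP #|S|; elim: m S => // m IH S.
case: (set_0Vmem S) => [->|[x xS]] cS ePS.
  by exists [::]; split => // y; rewrite inE.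
have [y yS exP] := ePS x xS.
have exy : e x y by rewrite exP ?eqxx.
have yx : y != x by apply: contraTneq exy => ->; rewrite ei.
have eyP z : z \in S -> e y z = (z == x).
  move=> zS; have [y' y'S h] := ePS y yS; rewrite h //.
  by have := h x xS; rewrite es exy => /esym/eqP->.
pose S' := S :\ x :\ y.
have [||s [us sS' os es']] := IH S'.
- have := cardsD1 y (S :\ x); have := cardsD1 x S.
  by rewrite !inE xS yS yx /= => h1 h2; move: cS; rewrite /S'; lia.
- move=> z; rewrite !inE => /and3P[zy zx zS].
  have [z' z'S h] := ePS z zS; exists z'; last first.
    by move=> w; rewrite !inE => /and3P[_ _]; apply: h.
  have ezz' : e z z' by rewrite h ?eqxx.
  rewrite !inE z'S andbT; apply/andP; split; apply/eqP => z'E.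
    by move: ezz'; rewrite z'E es eyP // (negPf zx).
  by move: ezz'; rewrite z'E es exP // (negPf zy).
have xs : x \notin s by rewrite sS' !inE eqxx andbF.
have ys : y \notin s by rewrite sS' !inE eqxx.
exists [:: x, y & s]; split => /=.
- by rewrite inE negb_or eq_sym yx xs ys.
- move=> z; rewrite !inE sS' !inE.
  by case: eqVneq => [->|_] //=; case: eqVneq => [->|_] //=; rewrite xS.
- by rewrite negbK.
have exs z : z \in s -> e x z = false.
  by rewrite sS' !inE => /and3P[zy _ zS]; rewrite exP // (negPf zy).
have eys z : z \in s -> e y z = false.
  by rewrite sS' !inE => /and3P[_ zx zS]; rewrite eyP // (negPf zx).
move=> x0 [|[|i]] [|[|j]] //=; rewrite ?ltnS ?ei ?exy //= => hi hj.
- by rewrite exs ?mem_nth.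
- by rewrite es exy.
- by rewrite eys ?mem_nth.
- by rewrite es exs ?mem_nth.
- by rewrite es eys ?mem_nth.
- by rewrite es' // !eqSS.
Qed.

End MatchingEnum.

(** * The complement off a removed set and the truncated Neumann series *)

Section Removal.
Variables (G : sgraph) (L : {set G}).
Implicit Types (i j : G).

(** The matrix [K] of the overview, kept on the whole vertex type by leaving the vertices of [L]
    isolated. *)
Definition nadj : rel G := fun i j => [&& i \notin L, j \notin L, i != j & ~~ adj i j].
Definition ndeg i : nat := #|[set j | nadj i j]|.
Definition deg_out i : nat := #|[set j | (j \notin L) && adj i j]|.
Definition deg_in i : nat := #|[set j | (j \in L) && adj i j]|.

Lemma nadj_sym : symmetric nadj.
Proof. by move=> i j; rewrite /nadj adj_sym eq_sym; case: (i \in L); case: (j \in L). Qed.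

Lemma nadj_irrefl : irreflexive nadj.
Proof. by move=> i; rewrite /nadj eqxx !andbF. Qed.

Lemma nadj_out i j : nadj i j -> (i \notin L) /\ (j \notin L).
Proof. by case/and4P. Qed.

Lemma deg_in_out i : (deg_in i + deg_out i = degree i)%N.
Proof.
rewrite /degree -(cardsID L); congr (_ + _)%N; apply: eq_card => j.
  by rewrite !inE andbC.
by rewrite !inE.
Qed.

(** Row [i] of the identity [J = I + K + A] off [L], which trades adjacency for the complement.
    General values let it count vertices as well as sum weights. *)
Lemma sum_split (V : nmodType) (g : G -> V) i : i \notin L ->
  \sum_(j | j \notin L) g j =
    g i + \sum_(j | nadj i j) g j + \sum_(j | (j \notin L) && adj i j) g j.
Proof.
move=> iL; rewrite (bigD1 i) //= (bigID (adj i)) /= -addrA; congr (_ + _).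
rewrite addrC; congr (_ + _); apply: eq_bigl => j.
  by rewrite /nadj iL -andbA eq_sym.
case: (eqVneq j i) => [->|_]; rewrite ?adj_irrefl ?andbF ?andbT //.
Qed.

Lemma card_split i : i \notin L -> #|~: L| = (1 + ndeg i + deg_out i)%N.
Proof.
move=> iL; rewrite /ndeg /deg_out -!sum1_card.
rewrite (eq_bigl (fun j => j \notin L)) => [|j]; last by rewrite inE.
have := sum_split (fun=> 1%N) iL; rewrite /= => ->.
by congr (_ + _ + _)%N; apply: eq_bigl => j; rewrite inE.
Qed.

Section Bound.
Variable R : realType.
Implicit Types (g h z : G -> R).

Definition nsum g i : R := \sum_(j | nadj i j) g j.

Lemma nsum_ge0 g : (forall j, j \notin L -> 0 <= g j) -> forall i, 0 <= nsum g i.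
Proof. by move=> g0 i; apply: sumr_ge0 => j /nadj_out[_ /g0]. Qed.

Lemma nsum_le g (c : R) i : (forall j, j \notin L -> g j <= c) ->
  nsum g i <= (ndeg i)%:R * c.
Proof.
move=> gc; rewrite mulr_natl /ndeg -sumr_const.
rewrite [leRHS](eq_bigl (nadj i)) => [|j]; last by rewrite inE.
by apply: ler_sum => j /nadj_out[_ /gc].
Qed.

(** By symmetry of [K], the total of [K g] weights each vertex by its complement degree. *)
Lemma sum_nsum g :
  \sum_(i | i \notin L) nsum g i = \sum_(i | i \notin L) (ndeg i)%:R * g i.
Proof.
rewrite (exchange_big_dep (fun j => j \notin L)) => [|i j _ /nadj_out[]//].
apply: eq_bigr => j jL; rewrite mulr_natl /ndeg -sumr_const.
apply: eq_bigl => i; rewrite inE nadj_sym; case: (boolP (nadj j i)) => [|_].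
  by move/nadj_out=> [_ ->].
by rewrite andbF.
Qed.

Lemma nsum_le_sum g i : (forall j, j \notin L -> 0 <= g j) ->
  nsum g i <= \sum_(j | j \notin L) g j.
Proof.
move=> g0; rewrite /nsum [leLHS]big_mkcond [leRHS]big_mkcond.
apply: ler_sum => j _; case: ifP => [/nadj_out[_ ->]//|_].
by case: ifP => // /g0.
Qed.

(* The vertices of [L] get weight [tau], the others weight [1 - z]; rewriting
   the adjacency matrix outside [L] through the complement graph turns the
   supersolution inequalities into conditions on [z]. *)
Lemma removal_bound (M tau b : R) z : 0 < tau ->
  (forall i, i \notin L -> z i < 1) ->
  (forall i, i \notin L ->
     M * z i + nsum z i <= (ndeg i)%:R - b - tau * (deg_in i)%:R) ->
  #|~: L|%:R - \sum_(i | i \notin L) z i < M + b ->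
  (forall i, i \in L ->
     \sum_(j | (j \notin L) && adj i j) (1 - z j) + tau * (deg_in i)%:R
       < (M - 1) * tau) ->
  forall a, eigenvalue (adjmx R G) a -> a < M - 1.
Proof.
move=> tau0 z1 Mz sumz HL.
pose y i := if i \in L then tau else 1 - z i.
have sumy i : \sum_(j | adj i j) y j =
    tau * (deg_in i)%:R + \sum_(j | (j \notin L) && adj i j) (1 - z j).
  rewrite (bigID (mem L)) /=; congr (_ + _).
    rewrite (eq_bigr (fun=> tau)) => [|j /andP[_ jL]]; last by rewrite /y jL.
    rewrite mulr_natr /deg_in -sumr_const; apply: eq_bigl => j.
    by rewrite inE andbC.
  rewrite [LHS](eq_bigl (fun j => (j \notin L) && adj i j)) => [|j]; last first.
    by rewrite andbC.
  by apply: eq_bigr => j /andP[jL _]; rewrite /y (negPf jL).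
apply: (@supersolution_gt_eigenvalue _ _ _ y) => i.
  by rewrite /y; case: ifPn => // /z1; rewrite subr_gt0.
rewrite sumy /y; case: ifPn => iL; first by rewrite addrC HL.
(* The sum over neighbours off [L] is the total weight minus the vertex's own weight minus the sum
   over non-neighbours. Strictness comes from the bound on the total. *)
have := sum_split (fun j => 1 - z j) iL; rewrite sumrB.
have -> : \sum_(j | j \notin L) (1 : R) = #|~: L|%:R.
  by rewrite -sumr_const; apply: eq_bigl => j; rewrite inE.
have -> : \sum_(j | nadj i j) (1 - z j) = (ndeg i)%:R - nsum z i.
  rewrite sumrB; congr (_ - _); rewrite /ndeg -sumr_const.
  by apply: eq_bigl => j; rewrite inE.
by move: (Mz i iL) sumz; lra.
Qed.

(* [z] consists of the first two terms of the Neumann series of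
   [(M + K)^-1 h], where [K] is the complement adjacency outside [L]. *)
Lemma first_order_bound (M tau B delta : R) (b : nat) (f : G -> nat) :
  0 < tau <= 1 -> 0 < M -> #|~: L|%:R = M + b%:R + delta ->
  (forall i, i \notin L ->
     [/\ ndeg i = (b + f i)%N, (deg_in i <= f i)%N & (f i)%:R < M]) ->
  delta * M ^+ 2 < \sum_(i | i \notin L)
    ((f i)%:R - tau * (deg_in i)%:R) * (M - b%:R - (f i)%:R) ->
  (forall i, i \notin L ->
     nsum (fun j => (f j)%:R - tau * (deg_in j)%:R) i <= (B - 1) * M ^+ 2) ->
  (forall i, i \in L ->
     B * (deg_out i)%:R + tau * (deg_in i)%:R < (M - 1) * tau) ->
  forall a, eigenvalue (adjmx R G) a -> a < M - 1.
Proof.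
move=> /andP[tau0 tau1] M0 cardR Hf HT HB HL.
pose h i : R := (f i)%:R - tau * (deg_in i)%:R.
have h0 i : i \notin L -> 0 <= h i.
  move=> iL; have [_ + _] := Hf i iL; rewrite -(ler_nat R) => df.
  by rewrite subr_ge0 (le_trans _ df) // ler_piMl.
have hM i : i \notin L -> h i < M.
  move=> iL; have [_ _] := Hf i iL; apply: le_lt_trans.
  by rewrite gerBl mulr_ge0 // ltW.
have M2 : 0 < M ^+ 2 by rewrite exprn_gt0.
pose z i := h i / M - nsum h i / M ^+ 2.
have nz i : nsum z i = nsum h i / M - nsum (nsum h) i / M ^+ 2.
  by rewrite /nsum sumrB -!mulr_suml.
have z1 i : i \notin L -> h i / M < 1 by move=> iL; rewrite ltr_pdivrMr // mul1r hM.
have nz0 i : 0 <= nsum h i / M ^+ 2 by rewrite divr_ge0 ?(ltW M2) ?nsum_ge0.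
apply: (@removal_bound M tau b%:R z) => //.
- by move=> i iL; apply: le_lt_trans (z1 i iL); rewrite /z gerBl.
- move=> i iL; have [-> _ _] := Hf i iL; rewrite nz /z.
  (* After an even number of terms the series telescopes to [h] minus a nonnegative remainder, which
     is the sign wanted here. *)
  have -> : M * (h i / M - nsum h i / M ^+ 2) +
      (nsum h i / M - nsum (nsum h) i / M ^+ 2) =
      h i - nsum (nsum h) i / M ^+ 2 by field; rewrite gt_eqF.
  have : 0 <= nsum (nsum h) i / M ^+ 2.
    by rewrite divr_ge0 ?(ltW M2) ?nsum_ge0 // => j _; apply: nsum_ge0.
  by rewrite natrD /h; lra.
- set T := \sum_(i | _) _ in HT.
  (* By [sum_nsum] the second term of [z] totals [h] weighted by [ndeg = b + f], which produces the
     factor [M - b - f]. *)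
  suff -> : \sum_(i | i \notin L) z i = T / M ^+ 2.
    by move: HT; rewrite -ltr_pdivlMr // cardR; lra.
  rewrite /T mulr_suml; transitivity
    (\sum_(i | i \notin L) (h i / M - (ndeg i)%:R * h i / M ^+ 2)).
    by rewrite [LHS]sumrB [RHS]sumrB -!mulr_suml sum_nsum.
  apply: eq_bigr => i /Hf[-> _ _]; rewrite natrD /h; field.
  by rewrite gt_eqF.
move=> i iL; apply: le_lt_trans (HL i iL); rewrite lerD2r mulrC mulr_natl.
rewrite /deg_out -sumr_const [leRHS](eq_bigl (fun j => (j \notin L) && adj i j)).
  apply: ler_sum => j /andP[jL _].
  (* [B] bounds the weights [1 - z j]: the first term of [z] only lowers them. *)
  have hB : nsum h j / M ^+ 2 <= B - 1 by rewrite ler_pdivrMr //; apply: HB.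
  have hj : 0 <= h j / M by rewrite divr_ge0 ?h0 ?ltW.
  by rewrite /z; lra.
by move=> j; rewrite inE.
Qed.

End Bound.
End Removal.

(** * Recognising [H1] and [H2] by their complement degrees *)

Lemma adj_nadj (G : sgraph) (L : {set G}) (i j : G) :
  i \notin L -> j \notin L -> adj i j = (i != j) && ~~ nadj L i j.
Proof.
move=> iL jL; rewrite /nadj iL jL /=.
by case: eqVneq => [->|_] /=; rewrite ?adj_irrefl ?negbK.
Qed.

Lemma giso_sym (G H : sgraph) : giso G H -> giso H G.
Proof.
move=> [f [g fK gK] fadj]; exists g; first by exists f.
by move=> x y; rewrite -fadj !gK.
Qed.

Lemma card_H1 n : (4 <= n)%N -> #|H1 n| = n.
Proof.
move=> n4; have : bijective (@H1_code n).
  by exists (@H1_decode n); [exact: H1_codeK | case=> [[]|[]]].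
move/bij_eq_card; rewrite !card_sum card_bool !card_ord => h.
by rewrite [LHS]h; lia.
Qed.

Lemma card_H2 n : (7 <= n)%N -> #|H2 n| = n.
Proof.
move=> n7; have : bijective (@H2_code n).
  by exists (@H2_decode n); [exact: H2_codeK | case=> [[[]|]|[[]|]]].
move/bij_eq_card; rewrite !card_sum card_prod card_unit card_bool !card_ord => h.
by rewrite [LHS]h; lia.
Qed.

Lemma giso_of_inj (G H : sgraph) (g : H -> G) : #|H| = #|G| -> injective g ->
  (forall x y, adj (g x) (g y) = adj x y) -> giso G H.
Proof.
move=> c gi ga; apply: giso_sym; exists g => //.
by apply: inj_card_bij => //; rewrite c.
Qed.

Lemma ndeg1P (G : sgraph) (L : {set G}) (x y : G) :
  ndeg L x = 1%N -> nadj L x y -> forall z, nadj L x z = (z == y).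
Proof.
move=> /eqP/cards1P[y0 E] xy z.
have in0 w : nadj L x w = (w == y0).
  by have := congr1 (fun A : {set G} => w \in A) E; rewrite !inE.
by move: xy; rewrite !in0 => /eqP->.
Qed.

Lemma ndeg2P (G : sgraph) (L : {set G}) (x : G) : ndeg L x = 2%N ->
  exists w : bool -> G, injective w /\ forall z, nadj L x z = (z == w false) || (z == w true).
Proof.
move=> /eqP/cards2P[a [b [ab E]]]; exists (fun c => if c then b else a); split.
  by case=> [] [] // /esym/eqP; rewrite ?(negPf ab) // eq_sym (negPf ab).
by move=> z; have := congr1 (fun A : {set G} => z \in A) E; rewrite !inE.
Qed.

Section Shapes.
Variables (G : sgraph) (u : G).
Let K := nadj [set u].

Lemma nadj1_neq x y : K x y -> y != u.
Proof. by case/nadj_out=> _; rewrite inE. Qed.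

(** Off a [K]-closed set the complement stays 1-regular, hence a perfect matching, so [G] induces a
    cocktail party graph there. *)
Lemma matching_outside (X : {set G}) :
  u \in X -> (forall x y, x \in X -> K x y -> y \in X) ->
  (forall x, x \notin X -> ndeg [set u] x = 1%N) ->
  exists s : seq G, [/\ uniq s, s =i ~: X, ~~ odd (size s),
    size s = (#|G| - #|X|)%N &
    forall i j, (i < size s)%N -> (j < size s)%N ->
      adj (nth u s i) (nth u s j) = (i != j) && (i./2 != j./2)%N].
Proof.
move=> uX clX d1.
have [x|s [us sX os es]] := matching_enum (nadj_sym [set u]) (nadj_irrefl _) (S := ~: X).
  rewrite inE => xX; have /eqP/cards1P[y E] := d1 x xX.
  have xy : K x y.
    by have := set11 y; rewrite -E inE.
  exists y; last by move=> z _; apply: ndeg1P (d1 x xX) xy z.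
  by rewrite inE; apply: contra xX => yX; apply: clX yX _; rewrite /K nadj_sym.
exists s; split => //.
  by rewrite -(card_uniqP us) (eq_card sX) cardsCs setCK.
move=> i j hi hj.
have nu k : (k < size s)%N -> nth u s k \notin [set u].
  move=> hk; have := mem_nth u hk; rewrite sX in_setC.
  by apply: contra; rewrite inE => /eqP->.
by rewrite (adj_nadj (L := [set u])) ?nu // nth_uniq // es //; case: (i == j).
Qed.

(** The complement of [G - u] is a path with centre [v] and ends [w false], [w true], together with
    a perfect matching of the rest. The ends are [V_2] and the matched vertices are [V_1]. *)
Lemma H1_shape (v : G) :
  (forall x, adj u x = (x == v)) -> ndeg [set u] v = 2%N ->
  (forall x, x != u -> x != v -> ndeg [set u] x = 1%N) ->
  ~~ odd #|G| /\ giso G (H1 #|G|).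
Proof.
move=> au dv d1.
have uv : v != u by apply/eqP => E; have := adj_irrefl u; rewrite au E eqxx.
have vu : (u == v) = false by rewrite eq_sym (negPf uv).
have [w [wi Kv]] := ndeg2P dv.
have Kvw c : K v (w c) by rewrite /K Kv; case: c; rewrite eqxx ?orbT.
have wu c : w c != u by apply: nadj1_neq (Kvw c).
have wv c : w c != v.
  by apply: contraTneq (Kvw c) => ->; rewrite /K nadj_irrefl.
have Kw c x : K (w c) x = (x == v).
  by apply: ndeg1P; [exact: d1 | rewrite nadj_sym; apply: Kvw].
pose X : {set G} := [set x in [:: u; v; w false; w true]].
have XE x : (x \in X) = [|| x == u, x == v, x == w false | x == w true].
  by rewrite !inE.
have wft : w false != w true by apply/eqP => /wi.
have cX : #|X| = 4%N.
  rewrite cardsE (card_uniqP _) //=.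
  by rewrite !inE !(eq_sym u) (negPf uv) !(negPf (wu _)) !(eq_sym v) !(negPf (wv _)) wft.
have wX c : w c \in X by rewrite XE; case: c; rewrite eqxx !orbT.
have [||x|s [us sX os ss adjs]] := @matching_outside X.
- by rewrite XE eqxx.
- move=> x y; rewrite XE => /or4P[] /eqP->.
  + by case/nadj_out; rewrite inE eqxx.
  + by rewrite /K Kv XE => /orP[] ->; rewrite !orbT.
  + by rewrite Kw XE => ->; rewrite orbT.
  + by rewrite Kw XE => ->; rewrite orbT.
- by rewrite XE !negb_or => /and4P[xu xv _ _]; apply: d1.
have n4 : (4 <= #|G|)%N by rewrite -cX max_card.
rewrite cX in ss; split; first by move: os; rewrite ss oddB // addbF.
have lts (i : 'I_(#|G| - 4)) : (i < size s)%N by rewrite ss.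
pose g (x : H1 #|G|) : G := match x : H1_vertex #|G| with
  | H1_u => u | H1_v => v | H1_V1 i => nth u s i | H1_V2 i => w (i != ord0) end.
have si i : nth u s (i : 'I_(#|G| - 4)) \notin X.
  by have := mem_nth u (lts i); rewrite sX in_setC.
have sN c i : (w c == nth u s (i : 'I_(#|G| - 4))) = false.
  by apply/eqP => E; have := si i; rewrite -E wX.
have sNu i : (nth u s (i : 'I_(#|G| - 4)) == u) = false.
  by apply/eqP => E; have := si i; rewrite E XE eqxx.
have sNv i : (nth u s (i : 'I_(#|G| - 4)) == v) = false.
  by apply/eqP => E; have := si i; rewrite E XE eqxx orbT.
have ord2 (i j : 'I_2) : ((i != ord0) == (j != ord0)) = (i == j).
  by case: i j => [[|[|]]] // ? [[|[|]]].
apply: (@giso_of_inj _ (H1 #|G|) g); first exact: card_H1.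
  move=> [||i|i] [||j|j] //= /eqP;
    rewrite ?sN ?sNu ?sNv ?(negPf (wu _)) ?(negPf (wv _)) ?(negPf uv) //;
    rewrite eq_sym ?sN ?sNu ?sNv ?(negPf (wu _)) ?(negPf (wv _)) ?(negPf uv) //.
    by rewrite nth_uniq // => /eqP/val_inj->.
  by rewrite (inj_eq wi) ord2 => /eqP->.
have L x : (x \notin [set u]) = (x != u) by rewrite inE.
have adjv x : x != u -> adj v x = [&& v != x, x != w false & x != w true].
  by move=> xu; rewrite (adj_nadj (L := [set u])) ?L // Kv negb_or.
have adjw c x : x != u -> adj (w c) x = (w c != x) && (x != v).
  by move=> xu; rewrite (adj_nadj (L := [set u])) ?L ?wu // -/K Kw.
move=> x y; rewrite -[RHS]/(H1_adj x y); case: x y => [||i|i] [||j|j] //=;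
  rewrite ?au ?eqxx ?vu ?sNu ?sNv ?(negPf (wv _)) //.
- by rewrite adj_sym au eqxx.
- by rewrite adj_irrefl.
- by rewrite adjv ?sNu // eq_sym sNv eq_sym sN eq_sym sN.
- by rewrite adjv // eq_sym wv /=; case: (j != ord0); rewrite eqxx ?andbF.
- by rewrite adj_sym au sNv.
- by rewrite adj_sym adjv ?sNu // eq_sym sNv eq_sym sN eq_sym sN.
- by rewrite adjs.
- by rewrite adj_sym adjw ?sNu // sN sNv.
- by rewrite adj_sym au (negPf (wv _)).
- by rewrite adj_sym adjv // eq_sym wv /=; case: (i != ord0); rewrite eqxx ?andbF.
- by rewrite adjw ?sNu // sN sNv.
- by rewrite adjw // wv andbT (inj_eq wi) ord2.
Qed.

(** The complement of [G - u] consists of two paths, with centre [v b] and ends [w b false],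
    [w b true], and a perfect matching of the rest. The paths are disjoint because each end has
    complement degree 1. *)
Lemma H2_shape (v : bool -> G) : injective v ->
  (forall x, adj u x = (x == v false) || (x == v true)) ->
  ~~ K (v false) (v true) -> (forall b, ndeg [set u] (v b) = 2%N) ->
  (forall x, x != u -> ~~ adj u x -> ndeg [set u] x = 1%N) ->
  odd #|G| /\ giso G (H2 #|G|).
Proof.
move=> vi au Kvv dv d1.
have auv b : adj u (v b) by rewrite au; case: b; rewrite eqxx ?orbT.
have uv b : v b != u by apply: contraTneq (auv b) => ->; rewrite adj_irrefl.
have [w0 [w0i Kv0]] := ndeg2P (dv false).
have [w1 [w1i Kv1]] := ndeg2P (dv true).
have [w wi Kv] : exists2 w : bool -> bool -> G, forall b, injective (w b) &
    forall b z, K (v b) z = (z == w b false) || (z == w b true).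
  by exists (fun b => if b then w1 else w0); case.
have Kvw b c : K (v b) (w b c) by rewrite Kv; case: c; rewrite eqxx ?orbT.
have KvvF b b' : K (v b) (v b') = false.
  case: b b' => [] []; try exact: nadj_irrefl; last exact: negPf.
  by rewrite /K nadj_sym; apply: negPf.
have wu b c : w b c != u by apply: nadj1_neq (Kvw b c).
have wv b c b' : w b c != v b'.
  by apply: contraTneq (Kvw b c) => ->; rewrite KvvF.
have wN b c : ~~ adj u (w b c) by rewrite au !(negPf (wv _ _ _)).
have Kw b c x : K (w b c) x = (x == v b).
  by apply: ndeg1P; [exact: d1 | rewrite nadj_sym; apply: Kvw].
have wE b c b' c' : (w b c == w b' c') = (b == b') && (c == c').
  apply/eqP/andP => [E|[/eqP-> /eqP->] //].
  have := Kw b c (v b); rewrite E Kw eqxx => /eqP/vi bb'; subst b'.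
  by move/wi: E => ->; rewrite !eqxx.
have vE b b' : (v b == v b') = (b == b') by rewrite (inj_eq vi).
pose X : {set G} := [set x in [:: u; v false; v true; w false false;
  w false true; w true false; w true true]].
have XE x : (x \in X) = [|| x == u, [exists b, x == v b] |
    [exists b, [exists c, x == w b c]]].
  apply/idP/idP.
    rewrite !inE => /or4P[->//|/eqP->|/eqP->|/or4P[]/eqP->].
    - by apply/or3P/Or32/existsP; exists false.
    - by apply/or3P/Or32/existsP; exists true.
    - by apply/or3P/Or33/existsP; exists false; apply/existsP; exists false.
    - by apply/or3P/Or33/existsP; exists false; apply/existsP; exists true.
    - by apply/or3P/Or33/existsP; exists true; apply/existsP; exists false.
    - by apply/or3P/Or33/existsP; exists true; apply/existsP; exists true.
  case/or3P=> [/eqP->|/existsP[b /eqP->]|/existsP[b /existsP[c /eqP->]]].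
  - by rewrite !inE eqxx.
  - by case: b; rewrite !inE eqxx ?orbT.
  - by case: b; case: c; rewrite !inE eqxx ?orbT.
have uX : u \in X by rewrite XE eqxx.
have vX b : v b \in X by rewrite XE; apply/or3P/Or32/existsP; exists b.
have wX b c : w b c \in X.
  by rewrite XE; apply/or3P/Or33/existsP; exists b; apply/existsP; exists c.
have cX : #|X| = 7%N.
  rewrite cardsE (card_uniqP _) //=.
  rewrite !inE !vE !wE !(eq_sym u) !(negPf (uv _)) !(negPf (wu _ _)) /=.
  by rewrite ![v _ == _]eq_sym !(negPf (wv _ _ _)).
have [|x y|x|s [us sX os ss adjs]] := @matching_outside X => //.
- rewrite XE => /or3P[/eqP->|/existsP[b /eqP->]|/existsP[b /existsP[c /eqP->]]].
  + by case/nadj_out; rewrite inE eqxx.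
  + by rewrite -/K Kv => /orP[] /eqP->.
  + by rewrite -/K Kw => /eqP->.
- move=> xX; apply: d1; first by apply: contraNneq xX => ->.
  by rewrite au; apply: contra xX => /orP[] /eqP->.
have n7 : (7 <= #|G|)%N by rewrite -cX max_card.
rewrite cX in ss; split; first by move: os; rewrite ss oddB // addbT negbK.
have lts (i : 'I_(#|G| - 7)) : (i < size s)%N by rewrite ss.
(* The negation is due to [H2] joining [H2_v b] to the class of the same index, whereas the [w b c]
   are the non-neighbours of [v b]. *)
pose g (x : H2 #|G|) : G := match x : H2_vertex #|G| with
  | H2_u => u | H2_v b => v b | H2_W b i => w (~~ b) (i != ord0)
  | H2_V3 i => nth u s i end.
have si i : nth u s (i : 'I_(#|G| - 7)) \notin X.
  by have := mem_nth u (lts i); rewrite sX in_setC.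
have sNw b c i : (w b c == nth u s (i : 'I_(#|G| - 7))) = false.
  by apply/eqP => E; have := si i; rewrite -E wX.
have sNu i : (nth u s (i : 'I_(#|G| - 7)) == u) = false.
  by apply/eqP => E; have := si i; rewrite E uX.
have sNv b i : (v b == nth u s (i : 'I_(#|G| - 7))) = false.
  by apply/eqP => E; have := si i; rewrite -E vX.
have ord2 (i j : 'I_2) : ((i != ord0) == (j != ord0)) = (i == j).
  by case: i j => [[|[|]]] // ? [[|[|]]].
have nb b c : (~~ b == ~~ c) = (b == c) by case: b c => [] [].
apply: (@giso_of_inj _ (H2 #|G|) g); first exact: card_H2.
  move=> [|b|b i|i] [|c|c j|j] //= /eqP;
    rewrite ?sNw ?sNu ?sNv ?(negPf (wu _ _)) ?(negPf (wv _ _ _)) ?(negPf (uv _)) //;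
    try by rewrite eq_sym ?sNw ?sNu ?sNv ?(negPf (wu _ _)) ?(negPf (wv _ _ _)) ?(negPf (uv _)).
  - by rewrite vE => /eqP->.
  - by rewrite wE nb ord2 => /andP[/eqP-> /eqP->].
  - by rewrite nth_uniq // => /eqP/val_inj->.
have L x : (x \notin [set u]) = (x != u) by rewrite inE.
have adjv b x : x != u -> adj (v b) x = [&& v b != x, x != w b false & x != w b true].
  by move=> xu; rewrite (adj_nadj (L := [set u])) ?L // -/K Kv negb_or.
have adjw b c x : x != u -> adj (w b c) x = (w b c != x) && (x != v b).
  by move=> xu; rewrite (adj_nadj (L := [set u])) ?L ?wu // -/K Kw.
have adju x : adj x u = adj u x by apply: adj_sym.
have adjvw b c i : adj (v b) (w (~~ c) (i != ord0 :> 'I_2)) = (b == c).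
  rewrite adjv // !wE eq_sym wv /=.
  by case: b c (i != ord0) => [] [] [].
have adjvs b i : adj (v b) (nth u s (i : 'I_(#|G| - 7))).
  by rewrite adjv ?sNu // sNv eq_sym sNw eq_sym sNw.
have adjws b c i : adj (w b c) (nth u s (i : 'I_(#|G| - 7))).
  by rewrite adjw ?sNu // sNw eq_sym sNv.
move=> x y; rewrite -[RHS]/(H2_adj x y).
case: x y => [|b|b i|i] [|c|c j|j] //=; rewrite ?adju ?adj_irrefl ?auv //.
- by rewrite (negPf (wN _ _)).
- by rewrite au eq_sym sNv eq_sym sNv.
- by rewrite adjv // vE ![v c == _]eq_sym !(negPf (wv _ _ _)) andbT.
- exact: adjvs.
- by rewrite (negPf (wN _ _)).
- by rewrite adj_sym adjvw eq_sym.
- by rewrite adjw // wv andbT wE nb ord2 -pair_eqE.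
- exact: adjws.
- by rewrite au eq_sym sNv eq_sym sNv.
- by rewrite adj_sym adjvs.
- by rewrite adj_sym adjws.
- by rewrite adjs.
Qed.

End Shapes.

(** * Degrees, connectedness and spectral radius of [H1] and [H2] *)

Lemma card_cocktail t (i : 'I_t) : ~~ odd t ->
  #|[pred j : 'I_t | cocktail_adj i j]| = (t - 2)%N.
Proof.
(* [p] is the partner of [i] in the deleted matching; it stays below [t] because [t] is even. *)
move=> et; pose p := if odd i then i.-1 else i.+1.
have pt : (p < t)%N by rewrite /p; have := ltn_ord i; case: ifP; lia.
have ip : i != Ordinal pt by rewrite -val_eqE /= /p; case: ifP; lia.
have E : [predC [pred j : 'I_t | cocktail_adj i j]] =i [set i; Ordinal pt].
  move=> j; rewrite !inE /cocktail_adj -!val_eqE /= /p.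
  by case: ifP; lia.
have := cardC [pred j : 'I_t | cocktail_adj i j].
rewrite (eq_card E) cards2 ip card_ord => h.
by apply: (@addIn 2); rewrite subnK ?h // -h leq_addl.
Qed.

Section SumsH1.
Variables (V : nmodType) (n : nat).

Lemma sum_H1 (F : H1 n -> V) : \sum_x F x =
  F (H1_u n) + F (H1_v n) + \sum_i F (H1_V1 i) + (F (H1_V2 n 0) + F (H1_V2 n 1)).
Proof.
rewrite (reindex (@H1_decode n)) /=; last first.
  exists (@H1_code n) => [c _|x _]; last exact: H1_codeK.
  by case: c => [[]|[]].
rewrite !big_sumType big_bool /= !big_ord_recl big_ord0 addr0 /= addrA.
by congr (_ + (F (H1_V2 n _) + F (H1_V2 n _))); apply: val_inj.
Qed.

Definition H1_fun (pu pv p1 p2 : V) (x : H1 n) : V :=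
  match x : H1_vertex n with
  | H1_u => pu | H1_v => pv | H1_V1 _ => p1 | H1_V2 _ => p2 end.

(** The classes form an equitable partition, so adjacency acts on class functions by the quotient
    matrix. Values in [nat] give the degrees, values in [R] the eigenvector. *)
Lemma sum_adj_H1 (pu pv p1 p2 : V) (x : H1 n) : (6 <= n)%N -> ~~ odd n ->
  \sum_(y | adj x y) H1_fun pu pv p1 p2 y =
  H1_fun pv (pu + p1 *+ (n - 4)) (pv + p1 *+ (n - 6) + p2 *+ 2)
    (p1 *+ (n - 4) + p2) x.
Proof.
move=> n6 en; rewrite big_mkcond sum_H1 /=.
have en4 : ~~ odd (n - 4) by lia.
case: x => [||i|i] /=; rewrite ?big1_eq ?sumr_const ?card_ord ?addr0 ?add0r //.
- rewrite -big_mkcond sumr_const card_cocktail // -mulr2n.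
  by have -> : (n - 4 - 2 = n - 6)%N by lia.
- by case: i => [[|[|]]] //= ?; rewrite ?addr0 ?add0r.
Qed.

End SumsH1.

Section SumsH2.
Variables (V : nmodType) (n : nat).

Lemma sum_H2 (F : H2 n -> V) : \sum_x F x =
  F (H2_u n) + \sum_b F (H2_v n b) +
  (\sum_b (F (H2_W n b 0) + F (H2_W n b 1)) + \sum_i F (H2_V3 i)).
Proof.
rewrite (reindex (@H2_decode n)) /=; last first.
  exists (@H2_code n) => [c _|x _]; last exact: H2_codeK.
  by case: c => [[[]|]|[[]|]].
rewrite !big_sumType /= (big_pred1 tt) => [|[]//]; congr (_ + (_ + _)).
transitivity (\sum_b \sum_i F (H2_W n b i)).
  by rewrite pair_bigA; apply: eq_bigr => [[b i] _].
apply: eq_bigr => b _; rewrite !big_ord_recl big_ord0 addr0.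
by congr (F (H2_W n b _) + F (H2_W n b _)); apply: val_inj.
Qed.

Definition H2_fun (pu pv pw p3 : V) (x : H2 n) : V :=
  match x : H2_vertex n with
  | H2_u => pu | H2_v _ => pv | H2_W _ _ => pw | H2_V3 _ => p3 end.

Lemma sum_adj_H2 (pu pv pw p3 : V) (x : H2 n) : (9 <= n)%N -> odd n ->
  \sum_(y | adj x y) H2_fun pu pv pw p3 y =
  H2_fun (pv *+ 2) (pu + pv + pw *+ 2 + p3 *+ (n - 7))
    (pv + pw *+ 3 + p3 *+ (n - 7)) (pv *+ 2 + pw *+ 4 + p3 *+ (n - 9)) x.
Proof.
move=> n9 en; rewrite big_mkcond sum_H2 /= !big_bool /=.
have en7 : ~~ odd (n - 7) by lia.
have E2 : forall p : V, p *+ 2 = p + p by move=> p; rewrite mulr2n.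
have E3 : forall p : V, p *+ 3 = p + p + p by move=> p; rewrite !mulrS mulr0n addr0 addrA.
case: x => [|b|b i|i] /=; rewrite ?big1_eq ?sumr_const ?card_ord ?addr0 ?add0r //.
- by case: b => /=; rewrite !(addr0, add0r) E2 !addrA.
- case: b i => [] [[|[|]]] //= ?; rewrite /= !(addr0, add0r) E3 !addrA //.
- rewrite -big_mkcond sumr_const card_cocktail // mulr2n.
  have -> : (n - 7 - 2 = n - 9)%N by lia.
  by rewrite (mulrnDr _ 2 2) mulr2n !addrA.
Qed.

End SumsH2.

Lemma degree_sum (G : sgraph) (x : G) : degree x = \sum_(y | adj x y) 1%N.
Proof. by rewrite sum1_card; apply: eq_card => y; rewrite inE. Qed.

Lemma degree_H1 n (x : H1 n) : (6 <= n)%N -> ~~ odd n ->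
  degree x = @H1_fun nat n 1%N (n - 3)%N (n - 3)%N (n - 3)%N x.
Proof.
move=> n6 en; rewrite degree_sum.
have := @sum_adj_H1 nat n 1%N 1%N 1%N 1%N x n6 en.
rewrite (eq_bigr (fun=> 1%N)) => [|y _]; last by case: y.
by move=> ->; case: x => [||i|i] /=; rewrite ?natn; lia.
Qed.

Lemma degree_H2 n (x : H2 n) : (9 <= n)%N -> odd n ->
  degree x = @H2_fun nat n 2%N (n - 3)%N (n - 3)%N (n - 3)%N x.
Proof.
move=> n9 en; rewrite degree_sum.
have := @sum_adj_H2 nat n 1%N 1%N 1%N 1%N x n9 en.
rewrite (eq_bigr (fun=> 1%N)) => [|y _]; last by case: y.
by move=> ->; case: x => [||i|i] /=; rewrite ?natn; lia.
Qed.

Lemma connected_root (G : sgraph) (r : G) :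
  (forall x, connect (@adj G) x r) -> connected G.
Proof.
move=> cr; split; first by apply/card_gt0P; exists r.
move=> x y; apply: connect_trans (cr x) _.
by rewrite (sym_connect_sym (@adj_sym G)).
Qed.

Lemma connected_H1 n : (6 <= n)%N -> connected (H1 n).
Proof.
move=> n6; apply: (@connected_root (H1 n) (H1_v n)) => x.
have n4 : (0 < n - 4)%N by lia.
case: x => [||i|i]; try exact: connect1; first exact: connect0.
by apply: (connect_trans (y := H1_V1 (Ordinal n4))); apply: connect1.
Qed.

Lemma connected_H2 n : (9 <= n)%N -> connected (H2 n).
Proof.
move=> n9; have n7 : (0 < n - 7)%N by lia.
apply: (@connected_root (H2 n) (H2_v n false)) => x.
case: x => [|[|]|[|] i|i]; try exact: connect1; try exact: connect0.
by apply: (connect_trans (y := H2_V3 (Ordinal n7))); apply: connect1.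
Qed.

Lemma max_degreeP (G : sgraph) d (r : G) :
  (forall x : G, (degree x <= d)%N) -> degree r = d -> max_degree G = d.
Proof.
move=> le dr; apply/eqP; rewrite eqn_leq; apply/andP; split.
  by apply/bigmax_leqP.
by rewrite -dr; apply: (leq_bigmax r).
Qed.

Lemma nonregular_class_H1 n : (6 <= n)%N -> ~~ odd n ->
  nonregular_class n (n - 3) (H1 n).
Proof.
move=> n6 en; split.
- by rewrite card_H1 //; lia.
- exact: connected_H1.
- by move/(_ (H1_u n) (H1_v n)); rewrite !degree_H1 //=; lia.
- by apply: (@max_degreeP (H1 n) _ (H1_v n)) => [x|]; rewrite degree_H1 //; case: x => /=; lia.
Qed.

Lemma nonregular_class_H2 n : (9 <= n)%N -> odd n ->
  nonregular_class n (n - 3) (H2 n).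
Proof.
move=> n9 en; split.
- by rewrite card_H2 //; lia.
- exact: connected_H2.
- by move/(_ (H2_u n) (H2_v n true)); rewrite !degree_H2 //=; lia.
- by apply: (@max_degreeP (H2 n) _ (H2_v n true)) => [x|]; rewrite degree_H2 //; case: x => /=; lia.
Qed.

(* The equation for [delta] is the characteristic equation of the quotient
   matrix on the four classes of vertices. *)
Lemma spectral_radius_H1 (R : realType) n (M delta : R) :
  (6 <= n)%N -> ~~ odd n -> 3 <= M -> n%:R = M + 2 + delta ->
  delta * (M ^+ 3 - M ^+ 2 - 3 * M + 2) = (M - 2) ^+ 2 ->
  is_spectral_radius (H1 n) (M - 1).
Proof.
move=> n6 en M3 nM dM.
pose D := M ^+ 3 - M ^+ 2 - 3 * M + 2.
have D0 : 0 < D.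
  have -> : D = (M - 3) * (M ^+ 2 + 2 * M + 3) + 11 by rewrite /D; ring.
  have sM := sqr_ge0 M; have p0 : 0 <= M ^+ 2 + 2 * M + 3 by lra.
  by rewrite ltr_wpDl // mulr_ge0 //; lra.
(* An eigenvector of the quotient matrix, scaled to have polynomial entries in [M]. *)
pose y := H1_fun (n := n) ((M - 2) * (M + 1)) ((M - 1) * (M - 2) * (M + 1)) D (D + (M - 2)).
apply: (@positive_eigenvector_spectral_radius _ (H1 n) _ y (H1_u n)).
  by case=> [||i|i] /=; do ?apply: mulr_gt0; move: D0; lra.
move=> x; rewrite /y sum_adj_H1 //.
have n4 : (n - 4)%:R = M - 2 + delta by rewrite natrB; [rewrite nM; lra | lia].
have n6' : (n - 6)%:R = M - 4 + delta by rewrite natrB; [rewrite nM; lra | lia].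
have D4 : D *+ (n - 4) = D * (M - 2) + (M - 2) ^+ 2.
  by rewrite -mulr_natr n4 mulrDr [D * delta]mulrC dM.
have D6 : D *+ (n - 6) = D * (M - 4) + (M - 2) ^+ 2.
  by rewrite -mulr_natr n6' mulrDr [D * delta]mulrC dM.
by case: x => [||i|i] /=; rewrite ?D4 ?D6 /D; ring.
Qed.

Lemma spectral_radius_H2 (R : realType) n (M delta : R) :
  (9 <= n)%N -> odd n -> 4 <= M -> n%:R = M + 2 + delta ->
  delta * (M ^+ 3 - M ^+ 2 - 4 * M + 2) = 2 * (M - 3) * (M - 2) ->
  is_spectral_radius (H2 n) (M - 1).
Proof.
move=> n9 en M3 nM dM.
pose D := M ^+ 3 - M ^+ 2 - 4 * M + 2.
have D0 : 0 < D.
  (* Division by [M - 4]: quotient and remainder are visibly positive. *)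
  have -> : D = (M - 4) * (M ^+ 2 + 3 * M + 8) + 34 by rewrite /D; ring.
  have sM := sqr_ge0 M; have p0 : 0 <= M ^+ 2 + 3 * M + 8 by lra.
  by rewrite ltr_wpDl // mulr_ge0 //; lra.
pose y := H2_fun (n := n) (2 * (M - 2) * (M + 1)) ((M - 1) * (M - 2) * (M + 1)) (D + (M - 3)) D.
apply: (@positive_eigenvector_spectral_radius _ (H2 n) _ y (H2_u n)).
  by case=> [|i|b i|i] /=; do ?apply: mulr_gt0; move: D0; lra.
move=> x; rewrite /y sum_adj_H2 //.
have n7 : (n - 7)%:R = M - 5 + delta by rewrite natrB; [rewrite nM; lra | lia].
have n9' : (n - 9)%:R = M - 7 + delta by rewrite natrB; [rewrite nM; lra | lia].
have D7 : D *+ (n - 7) = D * (M - 5) + 2 * (M - 3) * (M - 2).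
  by rewrite -mulr_natr n7 mulrDr [D * delta]mulrC dM.
have D9 : D *+ (n - 9) = D * (M - 7) + 2 * (M - 3) * (M - 2).
  by rewrite -mulr_natr n9' mulrDr [D * delta]mulrC dM.
by case: x => [|b|b i|i] /=; rewrite ?D7 ?D9 /D; ring.
Qed.

(** * Parity of the degree sum and edges leaving a set *)

Lemma sum_degree_even (G : sgraph) : ~~ odd (\sum_(x : G) degree x).
Proof.
pose lt (x y : G) := (enum_rank x < enum_rank y)%N.
(* Orienting each edge by enumeration rank counts it exactly once. *)
suff -> : (\sum_(x : G) degree x =
    (\sum_(x : G) \sum_(y | adj x y && lt x y) 1).*2)%N by rewrite odd_double.
rewrite -addnn [X in (_ + X)%N](exchange_big_dep xpredT) //= -big_split /=.
apply: eq_bigr => x _; rewrite degree_sum (bigID (lt x)) /=; congr (_ + _).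
apply: eq_bigl => y; rewrite adj_sym; apply: andb_id2l => yx.
rewrite /lt -leqNgt leq_eqVlt; case: eqP => // /val_inj/enum_rank_inj E.
by rewrite E adj_irrefl in yx.
Qed.

Lemma cut_edge (G : sgraph) (S : {set G}) (x y : G) : connected G ->
  x \in S -> y \notin S -> exists a b, [/\ a \in S, b \notin S & adj a b].
Proof.
move=> [_ cG] xS yS.
case: (pickP [pred p : G * G | [&& p.1 \in S, p.2 \notin S & adj p.1 p.2]]).
  by move=> [a b] /= /and3P[? ? ?]; exists a, b.
move=> no; have cl : closed (@adj G) (mem S).
  apply: intro_closed; first exact: (sym_connect_sym (@adj_sym G)).
  move=> a b ab aS; have := no (a, b).
  by rewrite /= ab andbT (aS : a \in S) /= => /negbFE.
by have := closed_connect cl (cG x y); rewrite /= xS (negPf yS).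
Qed.

Lemma ler_sum_term (R : numDomainType) (I : finType) (P : pred I) (g : I -> R) (i : I) :
  P i -> (forall j, P j -> 0 <= g j) -> g i <= \sum_(j | P j) g j.
Proof.
move=> Pi g0; rewrite (bigD1 i) //= lerDl; apply: sumr_ge0 => j /andP[Pj _].
exact: g0.
Qed.

(** * Numerical estimates for [delta] *)

Section Estimates.
Variables (R : realType) (M delta : R).

Lemma delta_M2 : 56 < M ->
  delta * (M ^+ 3 - M ^+ 2 - 4 * M + 2) <= 2 * (M - 3) * (M - 2) ->
  delta * M ^+ 2 < 2 * M - 15 / 2.
Proof.
move=> M56 dM.
pose D := M ^+ 3 - M ^+ 2 - 4 * M + 2.
(* Dividing [2 * (M - 3) * (M - 2) * M ^+ 2] by [D] gives quotient [2 * M - 8] and remainder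
   [12 * M ^+ 2 - 36 * M + 16]. The remainder is below [D / 2], whence the constant [15 / 2]. *)
have D0 : 0 < D - 2 * (12 * M ^+ 2 - 36 * M + 16).
  have -> : D - 2 * (12 * M ^+ 2 - 36 * M + 16) =
    (M - 25) * M ^+ 2 + (68 * M - 30) by rewrite /D; ring.
  by rewrite ltr_wpDl ?mulr_ge0 ?sqr_ge0 //; lra.
have D1 : 0 < D.
  have sM : 36 * M <= 12 * M ^+ 2 by rewrite expr2 mulrA ler_wpM2r //; lra.
  by lra.
rewrite -(ltr_pM2r D1).
have -> : delta * M ^+ 2 * D = (delta * D) * M ^+ 2 by ring.
apply: (@le_lt_trans _ _ (2 * (M - 3) * (M - 2) * M ^+ 2)).
  by rewrite ler_wpM2r ?sqr_ge0.
have -> : 2 * (M - 3) * (M - 2) * M ^+ 2 =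
  (2 * M - 15 / 2) * D - (D - 2 * (12 * M ^+ 2 - 36 * M + 16)) / 2.
  by rewrite /D; field.
by lra.
Qed.

Lemma delta_M : 56 < M -> delta * M ^+ 2 < 2 * M - 15 / 2 -> delta * M < 2.
Proof.
move=> M56; have M0 : 0 < M by lra.
by move=> h; rewrite -(ltr_pM2r M0) -mulrA -expr2; lra.
Qed.

Lemma delta_small : 56 < M -> 0 < delta -> delta * M < 2 -> delta < 1 / 28.
Proof. by nra. Qed.

End Estimates.

(** * Comparison of an arbitrary graph, by its vertices of degree at most 3 *)

Section Cases.
Variables (R : realType) (G : sgraph) (M delta : R).
Hypothesis cardG : #|G|%:R = M + 2 + delta.
Hypotheses (M_gt : 56 < M) (delta_gt0 : 0 < delta) (delta_lt : delta < 1 / 28).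
Hypotheses (deltaM : delta * M < 2) (deltaM2 : delta * M ^+ 2 < 2 * M - 15 / 2).
Hypothesis delta_char :
  delta * (M ^+ 3 - M ^+ 2 - 4 * M + 2) <= 2 * (M - 3) * (M - 2).
Hypothesis connG : connected G.
Hypothesis degG : forall x : G, (degree x <= #|G| - 3)%N.
Implicit Types (L : {set G}) (i j : G).

Let cardG_gt : (58 < #|G|)%N.
Proof. by rewrite -(ltr_nat R) cardG; move: M_gt delta_gt0; lra. Qed.

Let cardG3 : (#|G| - 3)%:R = M - 1 + delta.
Proof. by rewrite natrB ?cardG; [lra | move: cardG_gt; lia]. Qed.

(** The [f] of the overview: what [i] lacks in [G - L] to reach degree [#|G| - 3]. Off [L] this is
    the complement degree minus [2 - |L|], by [excessP]. *)
Definition excess L i : nat := (#|G| - 3 - deg_out L i)%N.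

Lemma card_setC_real L b : (#|L| + b = 2)%N -> #|~: L|%:R = M + b%:R + delta.
Proof.
move=> Lb; have := congr1 (fun k => k%:R : R) Lb.
have := congr1 (fun k => k%:R : R) (cardsC L).
by rewrite !natrD cardG; lra.
Qed.

Lemma excessP L b i : (#|L| + b = 2)%N -> i \notin L ->
  [/\ ndeg L i = (b + excess L i)%N, (deg_in L i <= excess L i)%N,
      (excess L i)%:R = M - 1 + delta - (deg_out L i)%:R & (excess L i)%:R < M].
Proof.
move: cardG_gt => n58 Lb iL; have cR := card_split iL; have cL := cardsC L.
have dio := deg_in_out L i; have di := degG i.
have e1 : (excess L i + deg_out L i = #|G| - 3)%N by rewrite /excess; lia.
have e2 := congr1 (fun k => k%:R : R) e1.
have e3 : (excess L i)%:R = M - 1 + delta - (deg_out L i)%:R.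
  by move: e2; rewrite natrD cardG3; lra.
split => //; [lia | lia |].
by rewrite e3; move: delta_lt (ler0n R (deg_out L i)); lra.
Qed.

(** The second alternative absorbs the truncated subtraction in [excess]. *)
Lemma excess_ge L i d : (d <= deg_out L i)%N ->
  (excess L i)%:R <= M - 1 + delta - d%:R \/ excess L i = 0%N.
Proof.
move: cardG_gt => n58 dd; have [le|lt] := leqP (deg_out L i) (#|G| - 3); last first.
  by right; rewrite /excess; lia.
left; have e1 : (excess L i + deg_out L i = #|G| - 3)%N by rewrite /excess; lia.
have := congr1 (fun k => k%:R : R) e1; rewrite natrD cardG3.
by move: dd; rewrite -(ler_nat R); lra.
Qed.

Lemma excess_bound L (b : nat) (tau B : R) : (#|L| + b = 2)%N -> 0 < tau <= 1 ->
  delta * M ^+ 2 < \sum_(i | i \notin L)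
    ((excess L i)%:R - tau * (deg_in L i)%:R) * (M - b%:R - (excess L i)%:R) ->
  (forall i, i \notin L ->
     nsum L (fun j => (excess L j)%:R - tau * (deg_in L j)%:R) i <= (B - 1) * M ^+ 2) ->
  (forall i, i \in L ->
     B * (deg_out L i)%:R + tau * (deg_in L i)%:R < (M - 1) * tau) ->
  forall a, eigenvalue (adjmx R G) a -> a < M - 1.
Proof.
move=> Lb tau01 HT HB HL.
apply: (@first_order_bound _ L _ M tau B delta b (excess L)) => //.
- by move: M_gt; lra.
- exact: card_setC_real.
by move=> i iL; have [? ? _ ?] := excessP Lb iL.
Qed.

Lemma excess_sub_ge0 L b (tau : R) i : (#|L| + b = 2)%N -> 0 < tau <= 1 ->
  i \notin L -> 0 <= (excess L i)%:R - tau * (deg_in L i)%:R.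
Proof.
move=> Lb /andP[t0 t1] iL; have [_ + _ _] := excessP Lb iL.
rewrite -(ler_nat R) => df.
by rewrite subr_ge0 (le_trans _ df) // ler_piMl.
Qed.

(* Allows [B = 2] in [excess_bound]. *)
Lemma nsum_excess_crude L b (tau : R) i : (#|L| + b = 2)%N -> (0 < #|L|)%N ->
  0 < tau <= 1 -> i \notin L ->
  nsum L (fun j => (excess L j)%:R - tau * (deg_in L j)%:R) i <= (2 - 1) * M ^+ 2.
Proof.
move=> Lb L0 t01 iL; have [nd _ ex _] := excessP Lb iL.
apply: (@le_trans _ _ ((ndeg L i)%:R * (M - 1 + delta))).
  apply: nsum_le => j jL; have [_ _ -> _] := excessP Lb jL.
  have : 0 <= tau * (deg_in L j)%:R by rewrite mulr_ge0 //; case/andP: t01 => /ltW.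
  by have := ler0n R (deg_out L j); lra.
have nM : (ndeg L i)%:R <= M + delta.
  rewrite nd natrD ex.
  have : (b%:R : R) <= 1 by rewrite lern1; lia.
  by have := ler0n R (deg_out L i); lra.
apply: (@le_trans _ _ ((M + delta) * (M - 1 + delta))).
  by rewrite ler_wpM2r //; move: M_gt delta_gt0; lra.
by rewrite expr2; move: M_gt delta_gt0 delta_lt; nra.
Qed.

(** For bounded total excess this allows [B] close to 1 in [excess_bound], where [nsum_excess_crude]
    only allows 2. *)
Lemma nsum_excess_sum L b (tau : R) i : (#|L| + b = 2)%N -> 0 < tau <= 1 ->
  i \notin L ->
  nsum L (fun j => (excess L j)%:R - tau * (deg_in L j)%:R) i
    <= (\sum_(j | j \notin L) excess L j)%:R.
Proof.
move=> Lb t01 iL.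
apply: (le_trans (nsum_le_sum i _)) => [j jL|]; first exact: (excess_sub_ge0 Lb).
rewrite natr_sum; apply: ler_sum => j jL.
by rewrite gerBl mulr_ge0 //; case/andP: t01 => /ltW.
Qed.

(* A vertex of excess [f] with [3 <= f <= M - c - 3 + delta] alone exceeds the
   required sum. *)
Lemma mid_excess (f c : R) : 3 <= f -> f <= M - c - 3 + delta -> 0 <= c <= 2 ->
  3 * M - 3 * c - 11 <= f * (M - c - f).
Proof.
move=> f3 fM /andP[c0 c2].
have h1 : 0 <= (f - 3) * (M - c - 3 + delta - f) by rewrite mulr_ge0 //; lra.
have h2 : (f - 3) * delta <= M * delta.
  by rewrite ler_pM2r //; move: delta_lt; lra.
by move: deltaM; nra.
Qed.

(** The right side is [M ^+ 4] times the total of the four Neumann terms in [single_excess2_bound].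
    It agrees with the largest admissible [delta * M ^+ 4] in the two leading coefficients and wins
    by about [4 * M]. *)
Lemma delta_M4 : delta * M ^+ 4 < 2 * M ^+ 3 - 8 * M ^+ 2 + 16 * M - 48.
Proof.
move: M_gt delta_char => M56 dM.
pose D := M ^+ 3 - M ^+ 2 - 4 * M + 2.
have M0 : 0 < M by lra.
have D0 : 0 < D.
  have -> : D = (M - 2) * M ^+ 2 + (M - 4) * M + 2 by rewrite /D; ring.
  by rewrite ltr_wpDl // addr_ge0 ?mulr_ge0 ?exprn_ge0 //; lra.
rewrite -(ltr_pM2r D0).
have -> : delta * M ^+ 4 * D = (delta * D) * M ^+ 4 by ring.
apply: (@le_lt_trans _ _ (2 * (M - 3) * (M - 2) * M ^+ 4)).
  by rewrite ler_wpM2r ?exprn_ge0 // ltW.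
rewrite -subr_gt0.
have -> : (2 * M ^+ 3 - 8 * M ^+ 2 + 16 * M - 48) * D -
    2 * (M - 3) * (M - 2) * M ^+ 4 =
    4 * (M - 16) * M ^+ 3 + 4 * (9 * M - 8) * M ^+ 2 + (28 * 8 * M - 12 * 8).
  by rewrite /D; ring.
by rewrite ltr_wpDl ?addr_ge0 ?mulr_ge0 ?exprn_ge0 //; lra.
Qed.

(* Here the first two terms of the Neumann series give equality up to order
   [M ^- 2], so four terms are needed. *)
Lemma single_excess2_bound (u : G) : excess set0 u = 2%N ->
  (forall i, i != u -> excess set0 i = 0%N) ->
  forall a, eigenvalue (adjmx R G) a -> a < M - 1.
Proof.
move=> eu e0.
have L2 : (#|set0 : {set G}| + 2 = 2)%N by rewrite cards0.
have in0 i : i \notin (set0 : {set G}) by rewrite inE.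
have M0 : 0 < M by move: M_gt; lra.
pose h i : R := (excess set0 i)%:R.
have hu : h u = 2 by rewrite /h eu.
have h0 i : i != u -> h i = 0 by move=> iu; rewrite /h e0.
have nd i : (ndeg set0 i)%:R = 2 + h i.
  by have [-> _ _ _] := excessP L2 (in0 i); rewrite natrD.
have di i : deg_in set0 i = 0%N.
  by apply/eqP; rewrite cards_eq0; apply/eqP/setP => j; rewrite !inE.
pose N := nsum (R := R) (set0 : {set G}).
have SE (g : G -> R) : \sum_(i | i \notin (set0 : {set G})) g i = \sum_i g i.
  by apply: eq_bigl => i; rewrite inE.
(* Complement degrees are 2 except for 4 at [u], so the totals of the iterates only require their
   values at [u]. *)
have SN g : \sum_i N g i = 2 * (\sum_i g i) + 2 * g u.
  rewrite -SE sum_nsum SE mulr_sumr -hu (bigD1 u) //= [X in _ = X + _](bigD1 u) //=.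
  rewrite nd (eq_bigr (fun i => 2 * g i)) => [|i iu]; first by rewrite hu; ring.
  by rewrite nd h0 // addr0.
have N0 g : (forall i, 0 <= g i) -> forall i, 0 <= N g i.
  by move=> g0 i; apply: nsum_ge0.
have hge i : 0 <= h i by rewrite /h.
have Sh : \sum_i h i = 2 by rewrite (bigD1 u) //= hu big1 ?addr0.
have h1u : N h u = 0.
  rewrite /N /nsum big1 // => j; case: (eqVneq j u) => [->|/h0//].
  by rewrite nadj_irrefl.
have h1j j : nadj set0 u j -> N h j = 2.
  move=> uj; rewrite /N /nsum (bigD1 u) /=; last by rewrite nadj_sym.
  by rewrite hu big1 ?addr0 // => k /andP[_ /h0].
have h2u : N (N h) u = 8.
  rewrite {1}/N /nsum (eq_bigr (fun=> 2)) => [|j /h1j//].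
  have := nd u; rewrite hu => nu.
  transitivity ((ndeg set0 u)%:R * (2 : R)); last by rewrite nu; ring.
  by rewrite mulr_natl /ndeg -sumr_const; apply: eq_bigl => j; rewrite inE.
have S1 : \sum_i N h i = 8 by rewrite SN Sh hu; ring.
have S2 : \sum_i N (N h) i = 16 by rewrite SN S1 h1u; ring.
have S3 : \sum_i N (N (N h)) i = 48 by rewrite SN S2 h2u; ring.
pose z i := h i / M - N h i / M ^+ 2 + N (N h) i / M ^+ 3 - N (N (N h)) i / M ^+ 4.
have Nz i : N z i = N h i / M - N (N h) i / M ^+ 2 + N (N (N h)) i / M ^+ 3 -
    N (N (N (N h))) i / M ^+ 4.
  by rewrite /N /nsum /z sumrB big_split sumrB -!mulr_suml.
have Mk k : 0 < M ^+ k by rewrite exprn_gt0.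
have ge0 g k i : (forall i, 0 <= g i) -> 0 <= N g i / M ^+ k.
  by move=> g0; rewrite divr_ge0 ?N0 ?ltW.
apply: (@removal_bound _ set0 _ M 1 2 z) => // [i _|i _||i]; last by rewrite inE.
- have h2 : h i / M <= 2 / 56.
    have : h i <= 2 by case: (eqVneq i u) => [->|/h0->]; rewrite ?hu.
    move=> hi; apply: ler_pM => //; first by rewrite invr_ge0 ltW.
    by rewrite lef_pV2 ?posrE //; move: M_gt; lra.
  have N2 : N (N h) i / M ^+ 3 <= 8 / 56.
    have N8 : N (N h) i <= 8.
      rewrite -S1 -SE; apply: nsum_le_sum => j _; exact: N0.
    apply: ler_pM => //; [exact: (N0 _ (N0 _ hge)) | by rewrite invr_ge0 ltW|].
    have M56 := M_gt; rewrite lef_pV2 ?posrE //.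
    by apply: (@le_trans _ _ (M ^+ 1)); [rewrite expr1 ltW | apply: ler_weXn2l => //; lra].
  have := ge0 h 2%N i hge; have := ge0 (N (N h)) 4%N i (N0 _ (N0 _ hge)).
  by rewrite /z; lra.
- rewrite -/(N z i) Nz nd di mulr0 subr0.
  have := ge0 _ 4%N i (N0 _ (N0 _ (N0 _ hge))).
  suff -> : M * z i + (N h i / M - N (N h) i / M ^+ 2 + N (N (N h)) i / M ^+ 3 -
    N (N (N (N h))) i / M ^+ 4) = h i - N (N (N (N h))) i / M ^+ 4 by lra.
  by rewrite /z; field; rewrite gt_eqF.
- rewrite (card_setC_real L2) SE /z sumrB big_split sumrB -!mulr_suml Sh S1 S2 S3 /=.
  have := delta_M4; rewrite -ltr_pdivlMr //.
  suff -> : (2 * M ^+ 3 - 8 * M ^+ 2 + 16 * M - 48) / M ^+ 4 =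
    2 / M - 8 / M ^+ 2 + 16 / M ^+ 3 - 48 / M ^+ 4 by lra.
  by field; rewrite gt_eqF.
Qed.

Lemma excess_set0 i : excess set0 i = (#|G| - 3 - degree i)%N.
Proof.
congr (_ - _)%N; apply: eq_card => j; by rewrite !inE.
Qed.

(** With [L] empty the total excess is positive since [G] is nonregular, and even by the handshake
    lemma. Two vertices of excess 1 yield [2 * (M - 3)], which beats [2 * M - 15 / 2]; a single
    vertex of excess 2 yields only [2 * (M - 4)] and is passed to [single_excess2_bound]. *)
Lemma min_degree4_bound : ~ regular G -> (forall x : G, (4 <= degree x)%N) ->
  forall a, eigenvalue (adjmx R G) a -> a < M - 1.
Proof.
move=> nreg d4.
have L2 : (#|set0 : {set G}| + 2 = 2)%N by rewrite cards0.
have in0 i : i \notin (set0 : {set G}) by rewrite inE.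
have di i : deg_in set0 i = 0%N.
  by apply/eqP; rewrite cards_eq0; apply/eqP/setP => j; rewrite !inE.
pose f := excess (set0 : {set G}).
have fM i : (f i)%:R <= M - 5 + delta.
  rewrite /f; have := @excess_ge set0 i 4.
  case=> [|h|->]; last by move: M_gt delta_gt0; lra.
    by have := deg_in_out set0 i; rewrite di add0n => ->.
  by apply: le_trans h _; lra.
suff [[u [eu e0]]|HT] : (exists u, f u = 2%N /\ forall i, i != u -> f i = 0%N) \/
    delta * M ^+ 2 < \sum_i (f i)%:R * (M - 2 - (f i)%:R).
- exact: single_excess2_bound eu e0.
- pose S : R := \sum_(i | i \notin (set0 : {set G})) (f i)%:R.
  have M2 : 0 < M ^+ 2 by rewrite exprn_gt0 //; move: M_gt; lra.
  apply: (@excess_bound set0 2 1 (S / M ^+ 2 + 1)) => //.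
  + by rewrite ltr01 lexx.
  + apply: (lt_le_trans HT); rewrite le_eqVlt; apply/orP; left; apply/eqP.
    rewrite [LHS](eq_bigl (fun i => i \notin (set0 : {set G}))) => [|i]; last by rewrite inE.
    by apply: eq_bigr => i _; rewrite di mulr0 subr0.
  + move=> i iL; rewrite addrK divfK ?gt_eqF //.
    rewrite /S -natr_sum; apply: (@nsum_excess_sum _ 2) => //.
    by rewrite ltr01 lexx.
  by move=> i; rewrite inE.
have g0 i : 0 <= (f i)%:R * (M - 2 - (f i)%:R).
  by rewrite mulr_ge0 //; move: (fM i) delta_lt; lra.
have [/existsP[i f3]|/existsPn f2] := boolP [exists i, 3 <= f i]%N.
  right; apply: (lt_le_trans _ (@ler_sum_term _ _ xpredT _ i isT _)) => //.
  have f3' : 3 <= (f i)%:R :> R by rewrite (ler_nat R 3).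
  have := @mid_excess (f i)%:R 2 f3'.
  move: (fM i) deltaM2 M_gt => h1 h2 h3 h4.
  by apply: lt_le_trans (h4 _ _); lra.
have f2' i : (f i <= 2)%N by have := f2 i; lia.
have evF : ~~ odd (\sum_i f i).
  have : (\sum_i f i + \sum_(i : G) degree i = #|G| * (#|G| - 3))%N.
    rewrite -big_split /= (eq_bigr (fun=> (#|G| - 3)%N)) => [|i _].
      by rewrite sum_nat_const.
    by rewrite /f excess_set0 subnK.
  have := sum_degree_even G; have := cardG_gt; move: (\sum_(i : G) degree i)%N => d.
  move=> n58 od /(congr1 odd); rewrite oddD (negPf od) addbF => ->.
  by rewrite oddM oddB; last (by lia); case: (odd #|G|).
have F0 : (0 < \sum_i f i)%N.
  rewrite lt0n sum_nat_eq0; apply/negP => /forallP f0; apply: nreg.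
  have dE (x : G) : degree x = (#|G| - 3)%N.
    have := f0 x; rewrite /f excess_set0 /= subn_eq0 => h.
    by apply/eqP; rewrite eqn_leq h degG.
  by move=> x y; rewrite !dE.
have [F3|F2] := leqP 3 (\sum_i f i).
  right; apply: (@lt_le_trans _ _ (\sum_i (f i)%:R * (M - 4))); last first.
    apply: ler_sum => i _; apply: ler_wpM2l => //.
    by have := f2' i; rewrite -(ler_nat R); lra.
  rewrite -mulr_suml -natr_sum.
  have F3' : 3 <= (\sum_i f i)%:R :> R by rewrite (ler_nat R 3).
  apply: (@lt_le_trans _ _ (3 * (M - 4))); first by move: deltaM2 M_gt; lra.
  by rewrite ler_wpM2r //; move: M_gt; lra.
have {F2 F0}F2 : (\sum_i f i = 2)%N.
  by move: F0 F2 evF; case: (\sum_i f i)%N => [|[|[|]]].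
have [/existsP[u /eqP fu]|/existsPn f1] := boolP [exists i, f i == 2].
  left; exists u; split => // i iu.
  move: F2; rewrite (bigD1 u) //= (bigD1 i) //= fu; lia.
right; rewrite (eq_bigr (fun i => (f i)%:R * (M - 3))) => [|i _].
  by rewrite -mulr_suml -natr_sum F2; move: deltaM2; lra.
have : (f i <= 1)%N by have := f1 i; have := f2' i; lia.
by case: (f i) => [|[|//]] _; rewrite ?mul0r //; ring.
Qed.

(** [t] scales the supersolution of [nonadjacent_neighbours_bound]. The last three conditions give,
    in order, a positive weight at [u], the inequality at [u], and the bound on the total weight. *)
Lemma exists_weight : exists t : R,
  [/\ 0 < t, t * (M ^+ 2 + M - 1) < 1, t * (M ^+ 3 - 4 * M + 1) < M - 3 &
      delta < 2 * t * (M - 1)].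
Proof.
move: M_gt delta_gt0 delta_char => M56 d0 dM.
pose D := M ^+ 3 - 4 * M + 1.
have M0 : 0 <= M by lra.
have M2 : 0 <= M ^+ 2 by rewrite exprn_ge0.
have DE : D = M * M ^+ 2 - 4 * M + 1 by rewrite /D; ring.
have DQ : (M - 3) * (M ^+ 2 + M - 1) + 2 * M ^+ 2 - 2 = D by rewrite /D; ring.
have MM : 56 * M <= M ^+ 2 by rewrite expr2 ler_wpM2r // ltW.
have MMM : 56 * M ^+ 2 <= M * M ^+ 2 by rewrite ler_wpM2r // ltW.
have D0 : 0 < D by rewrite DE; lra.
(* Equality here would be the characteristic equation of the competitor; its gap to that of [H2] is
   the positive term [delta * (M * (M - 3))]. *)
have dD : delta * D < 2 * (M - 1) * (M - 3).
  have M20 : 0 < M - 2 by lra.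
  rewrite -(ltr_pM2r M20).
  have h : delta * (M ^+ 3 - M ^+ 2 - 4 * M + 2) * (M - 1) <=
      2 * (M - 3) * (M - 2) * (M - 1) by rewrite ler_wpM2r //; lra.
  have h' : 0 < delta * (M * (M - 3)) by rewrite !mulr_gt0 //; lra.
  have -> : delta * D * (M - 2) =
    delta * (M ^+ 3 - M ^+ 2 - 4 * M + 2) * (M - 1) - delta * (M * (M - 3)).
    by rewrite /D; ring.
  by lra.
(* [lo] and [hi] are the limits set for [t] by the fourth and third conditions; their midpoint is
   taken. *)
pose lo := delta / (2 * (M - 1)); pose hi := (M - 3) / D.
have M1 : 0 < 2 * (M - 1) by lra.
have lohi : lo < hi.
  by rewrite /lo /hi ltr_pdivrMr // mulrAC ltr_pdivlMr //; lra.
have lo0 : 0 < lo by rewrite divr_gt0.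
have loE : delta = lo * (2 * (M - 1)) by rewrite /lo divfK ?gt_eqF.
have hiE : hi * D = M - 3 by rewrite /hi divfK ?gt_eqF.
exists ((lo + hi) / 2); split.
- by lra.
- apply: (@le_lt_trans _ _ (hi * (M ^+ 2 + M - 1))).
    by rewrite ler_wpM2r //; lra.
  by rewrite /hi mulrAC ltr_pdivrMr // mul1r; lra.
- by rewrite -hiE -/D ltr_pM2r //; lra.
rewrite {1}loE.
have -> : 2 * ((lo + hi) / 2) * (M - 1) = (lo + hi) / 2 * (2 * (M - 1)) by ring.
by rewrite ltr_pM2r //; lra.
Qed.

Lemma deg_in1 (u i : G) : deg_in [set u] i = adj i u.
Proof.
rewrite /deg_in; case: (boolP (adj i u)) => iu.
  transitivity #|[set u]|; last exact: cards1.
  apply: eq_card => j; rewrite !inE.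
  by case: eqVneq => [->|].
apply/eqP; rewrite cards_eq0; apply/eqP/setP => j; rewrite !inE.
by case: eqVneq => [->|//]; rewrite (negPf iu).
Qed.

Lemma deg_out1 (u : G) : deg_out [set u] u = degree u.
Proof. by rewrite -(deg_in_out [set u] u) deg_in1 adj_irrefl. Qed.

(* This competitor agrees with [H2] up to order [M ^- 2], so the weights are
   those of the exact eigenvector of its quotient matrix, up to the choice of [t]. *)
Lemma nonadjacent_neighbours_bound (u : G) (v : bool -> G) : injective v ->
  (forall x, adj u x = (x == v false) || (x == v true)) ->
  nadj [set u] (v false) (v true) -> (forall b, ndeg [set u] (v b) = 2%N) ->
  (forall x, x != u -> ~~ adj u x -> ndeg [set u] x = 1%N) ->
  forall a, eigenvalue (adjmx R G) a -> a < M - 1.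
Proof.
move=> vi au Kvv dv d1.
pose K := nadj [set u].
have auv b : adj u (v b) by rewrite au; case: b; rewrite eqxx ?orbT.
have uv b : v b != u by apply: contraTneq (auv b) => ->; rewrite adj_irrefl.
have vN b : v (~~ b) != v b by apply/eqP => /vi; case: b.
have Kvn b : K (v b) (v (~~ b)) by case: b => //; rewrite /K nadj_sym.
(* In the complement of [G - u] the vertices [w false], [v false], [v true], [w true] form a
   path. *)
have [w [wN Kv]] : exists w : bool -> G, (forall b, w b != v (~~ b)) /\
    forall b x, K (v b) x = (x == v (~~ b)) || (x == w b).
  suff h b : exists y, y != v (~~ b) /\ forall x, K (v b) x = (x == v (~~ b)) || (x == y).
    have [y0 [h0 K0]] := h false; have [y1 [h1 K1]] := h true.
    by exists (fun b => if b then y1 else y0); split; case.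
  have [y [yi Ky]] := ndeg2P (dv b).
  have := Kvn b; rewrite /K Ky => /orP[]/eqP E.
    exists (y true); split; first by rewrite E; apply/eqP => /yi.
    by move=> x; rewrite Ky E.
  exists (y false); split; first by rewrite E; apply/eqP => /yi.
  by move=> x; rewrite Ky E orbC.
have Kvw b : K (v b) (w b) by rewrite Kv eqxx orbT.
have wu b : w b != u by apply: nadj1_neq (Kvw b).
have wv b b' : w b != v b'.
  have wvb : w b != v b by apply: contraTneq (Kvw b) => ->; rewrite /K nadj_irrefl.
  by case: (eqVneq b' b) (wN b) => [->//|]; case: b' b wvb => [] [].
have Kw b x : K (w b) x = (x == v b).
  apply: ndeg1P; last by rewrite nadj_sym; apply: Kvw.
  by apply: d1 => //; rewrite au !(negPf (wv _ _)).
have [t [t0 tQ tD dt]] := exists_weight.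
have M56 := M_gt.
pose D (y x : G) : R := (x == y)%:R.
(* The coefficients [M] and [- 1] make [M z + K z] vanish off the two neighbours of [u]. *)
pose z (x : G) := t * (M * (D (v false) x + D (v true) x) - (D (w false) x + D (w true) x)).
have ND y x : nsum [set u] (D y) x = (K y x)%:R.
  rewrite /nsum /D big_mkcond (bigD1 y) //= eqxx big1 ?addr0 => [|j /negPf jy].
    by rewrite nadj_sym -/(K y x); case: (K y x).
  by rewrite jy; case: ifP.
have NDv b x : nsum [set u] (D (v b)) x = D (v (~~ b)) x + D (w b) x.
  rewrite ND Kv /D -natrD; congr (_%:R); case: eqVneq => [->|//] /=.
  by rewrite eq_sym (negPf (wN b)).
have NDw b x : nsum [set u] (D (w b)) x = D (v b) x by rewrite ND Kw.
have Nz x : nsum [set u] z x = t * (M * (D (v false) x + D (v true) x +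
    (D (w false) x + D (w true) x)) - (D (v false) x + D (v true) x)).
  rewrite {1}/nsum /z -mulr_sumr sumrB -mulr_sumr !big_split /=.
  by rewrite -!/(nsum [set u] _ x) !NDv !NDw /=; congr (t * (M * _ - _)); ring.
have inu x : (x \notin [set u]) = (x != u) by rewrite inE.
have zv b : z (v b) = t * M.
  rewrite /z /D ![v b == w _]eq_sym !(negPf (wv _ _)) !(inj_eq vi).
  by case: b => /=; ring.
have SD y : y != u -> \sum_(x | x \notin [set u]) D y x = 1.
  move=> yu; rewrite (bigD1 y) ?inu //= /D eqxx big1 ?addr0 //.
  by move=> j /andP[_ /negPf->].
have L1 : (#|[set u]| + 1 = 2)%N by rewrite cards1.
have tM : t * M < 1.
  have h : t * M <= t * (M ^+ 2 + M - 1).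
    have m2 : 1 <= M ^+ 2 by rewrite exprn_ege1 //; lra.
    by rewrite ler_pM2l //; lra.
  by lra.
have tM0 : 0 <= t * M by rewrite mulr_ge0 ?ltW //; lra.
apply: (@removal_bound _ [set u] _ M (1 - t * (M ^+ 2 + M - 1)) 1 z).
- by lra.
- move=> i; rewrite inu => iu.
  have [/existsP[b /eqP->]|/existsPn iv] := boolP [exists b, i == v b].
    by rewrite zv.
  rewrite /z /D !(negPf (iv _)) addr0 mulr0 sub0r mulrN.
  apply: (@le_lt_trans _ _ 0) => //; rewrite oppr_le0.
  by rewrite mulr_ge0 ?addr_ge0 // ltW.
- move=> i; rewrite inu => iu; rewrite Nz deg_in1 adj_sym.
  have -> : M * z i + t * (M * (D (v false) i + D (v true) i +
      (D (w false) i + D (w true) i)) - (D (v false) i + D (v true) i)) =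
      t * (M ^+ 2 + M - 1) * (D (v false) i + D (v true) i) by rewrite /z; ring.
  have [/existsP[b /eqP->]|/existsPn iv] := boolP [exists b, i == v b].
    rewrite dv auv /D !(inj_eq vi); case: b => /=; lra.
  have uiF : adj u i = false by rewrite au !(negPf (iv _)).
  by rewrite d1 ?uiF // /D !(negPf (iv _)) addr0 !mulr0 subr0 subrr.
- rewrite (card_setC_real L1) /z -mulr_sumr sumrB -mulr_sumr !big_split /= !SD //.
  by move: dt; lra.
move=> i; rewrite inE => /eqP->.
rewrite deg_in1 adj_irrefl mulr0 addr0.
rewrite (eq_bigl (fun j => (j == v false) || (j == v true))) => [|j]; last first.
  rewrite inu au; case: eqVneq => [->|//] /=.
  by rewrite ![u == _]eq_sym !(negPf (uv _)).
rewrite (eq_bigr (fun=> 1 - t * M)) => [|j /orP[]/eqP->]; rewrite ?zv //.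
rewrite (bigD1 (v false)) ?eqxx //= (big_pred1 (v true)) => [|j /=]; last first.
  case: (eqVneq j (v true)) => [->|]; last by rewrite orbF andbN.
  by rewrite orbT; apply: (vN false).
have -> : (M - 1) * (1 - t * (M ^+ 2 + M - 1)) =
  2 * (1 - t * M) + (M - 3 - t * (M ^+ 3 - 4 * M + 1)) by ring.
by lra.
Qed.

Lemma deg_in_bool (u i : G) : (deg_in [set u] i)%:R = (adj u i)%:R :> R.
Proof. by rewrite deg_in1 adj_sym. Qed.

(** With [L] reduced to [u], every neighbour of [u] has positive excess, so the degree [k] of [u] is
    at most the total excess [F]. Large [F] is settled crudely. What remains is [k = F = 1], which
    is [H1]; [k = 1] and [F = 2], which is beaten; and [k = F = 2], which is [H2] or its competitor
    according to whether the neighbours of [u] are adjacent. *)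
Lemma one_low_vertex (u : G) :
  (degree u <= 3)%N -> (forall x, x != u -> (4 <= degree x)%N) ->
  [\/ ~~ odd #|G| /\ giso G (H1 #|G|), odd #|G| /\ giso G (H2 #|G|) |
      forall a, eigenvalue (adjmx R G) a -> a < M - 1].
Proof.
move=> du3 d4; have M56 := M_gt; have ds := delta_lt; have d0 := delta_gt0.
have dM2 := deltaM2.
have L1 : (#|[set u]| + 1 = 2)%N by rewrite cards1.
have inu x : (x \notin [set u]) = (x != u) by rewrite inE.
pose f := excess [set u].
have fP i : i != u -> ndeg [set u] i = (f i).+1 /\ (adj u i <= f i)%N.
  rewrite -inu => iu; have [-> + _ _] := excessP L1 iu.
  by rewrite deg_in1 adj_sym.
have fM i : i != u -> (f i)%:R <= M - 4 + delta.
  move=> iu; rewrite /f; have := @excess_ge [set u] i 3.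
  case=> [|h|->]; last by lra.
    have := deg_in_out [set u] i; have := d4 i iu; rewrite deg_in1.
    by case: (adj i u); lia.
  by lra.
pose k := degree u.
have sum_adj : (\sum_(i | i \notin [set u]) adj u i = k)%N.
  rewrite /k degree_sum [RHS]big_mkcond [LHS]big_mkcond; apply: eq_bigr => i _.
  by rewrite inu; case: eqVneq => [->|_]; rewrite ?adj_irrefl //; case: adj.
have k1 : (0 < k)%N.
  have [y yu] : exists y, y \notin [set u].
    have := cardsC [set u]; rewrite cards1 => c.
    have : (0 < #|~: [set u]|)%N by move: c cardG_gt; lia.
    by case/card_gt0P => y; rewrite inE => yu; exists y.
  have [a [b [/set1P-> bu ab]]] := cut_edge connG (set11 u) yu.
  by apply/card_gt0P; exists b; rewrite inE.
pose F := (\sum_(i | i \notin [set u]) f i)%N.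
have kF : (k <= F)%N.
  by rewrite -sum_adj; apply: leq_sum => i; rewrite inu => /fP[].
pose Q := \sum_(i | i \notin [set u]) (f i)%:R * (M - 1 - (f i)%:R).
have key tau : 0 < tau <= 1 -> Q - tau * (M - 1) * k%:R <=
    \sum_(i | i \notin [set u])
      ((f i)%:R - tau * (deg_in [set u] i)%:R) * (M - 1%:R - (f i)%:R).
  move=> /andP[t0 t1]; rewrite -sum_adj natr_sum mulr_sumr -sumrB.
  apply: ler_sum => i _; rewrite deg_in_bool.
  have : 0 <= tau * (adj u i)%:R * (f i)%:R by rewrite !mulr_ge0 // ltW.
  by lra.
have Q0 i : i \notin [set u] -> 0 <= (f i)%:R * (M - 1 - (f i)%:R).
  by rewrite inu => /fM h; rewrite mulr_ge0 //; lra.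
have crude : delta * M ^+ 2 + 20 < Q ->
    forall a, eigenvalue (adjmx R G) a -> a < M - 1.
  (* [tau * (M - 1)] must exceed [B * k], at most 6, while the loss of 13/2 for each neighbour stays
     below 20 in all. *)
  move=> HQ; pose tau := 13 / 2 / (M - 1).
  have tE : tau * (M - 1) = 13 / 2 by rewrite /tau divfK // gt_eqF //; lra.
  have t01 : 0 < tau <= 1.
    by rewrite divr_gt0 //= ?ler_pdivrMr; lra.
  have k3 : k%:R <= 3 :> R by rewrite (ler_nat R _ 3).
  apply: (@excess_bound [set u] 1 tau 2) => //.
  - by apply: lt_le_trans (key _ t01); rewrite tE; lra.
  - by move=> i iL; apply: (@nsum_excess_crude _ 1); rewrite ?cards1.
  move=> i; rewrite inE => /eqP->.
  by rewrite deg_in1 adj_irrefl mulr0 addr0 deg_out1 -/k; lra.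
have [/existsP[i /andP[iu f3]]|/existsPn f2] := boolP [exists i, (i != u) && (3 <= f i)%N].
  apply: Or33; apply: crude.
  apply: (lt_le_trans _ (@ler_sum_term _ _ _ _ i _ Q0)); last by rewrite inu.
  have f3' : 3 <= (f i)%:R :> R by rewrite (ler_nat R 3).
  have := @mid_excess (f i)%:R 1 f3'; have := fM i iu => h1 h2.
  by apply: lt_le_trans (h2 _ _); lra.
have f2' i : i \notin [set u] -> (f i <= 2)%N.
  by rewrite inu => iu; have := f2 i; rewrite iu /=; lia.
have QF : F%:R * (M - 3) <= Q.
  rewrite /F natr_sum mulr_suml; apply: ler_sum => i iu; apply: ler_wpM2l => //.
  by have := f2' i iu; rewrite -(ler_nat R); lra.
have [F3|F2] := leqP 3 F.
  apply: Or33; apply: crude; apply: lt_le_trans QF.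
  have F3' : 3 <= F%:R :> R by rewrite (ler_nat R 3).
  apply: (@lt_le_trans _ _ (3 * (M - 3))); first by lra.
  by rewrite ler_wpM2r //; lra.
have f_pos x : adj u x -> (0 < f x)%N.
  move=> ux; have xu : x != u by apply: contraTneq ux => ->; rewrite adj_irrefl.
  by have [_] := fP x xu; rewrite ux.
have [k2|k2] := ltnP 1 k; last first.
  have kE : k = 1%N by move: k1 k2; clear; lia.
  have /eqP/cards1P[v Ev] := kE.
  have au x : adj u x = (x == v).
    by have := congr1 (fun A : {set G} => x \in A) Ev; rewrite !inE.
  have vu : v != u by apply/eqP => E; have := adj_irrefl u; rewrite au E eqxx.
  have FE : F = (f v + \sum_(i | (i \notin [set u]) && (i != v)) f i)%N.
    by rewrite /F (bigD1 v) ?inu.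
  have fv : (0 < f v)%N by rewrite f_pos ?au ?eqxx.
  have [F1|F1] := leqP F 1.
    apply: Or31; apply: (@H1_shape _ u v) => //.
      by have [-> _] := fP v vu; congr _.+1; move: FE F1 fv; clear; lia.
    move=> x xu xv; have [-> _] := fP x xu; congr _.+1.
    by move: FE F1 fv; rewrite (bigD1 x) ?inu ?xu //=; clear; lia.
  have {F1 F2}FE2 : F = 2%N by move: F1 F2; clear; lia.
  (* [tau * (M - 1)] has to lie between [B = 101 / 100] and [3 / 2], the slack of [2 * (M - 3)] over
     [2 * M - 15 / 2]. *)
  apply: Or33; pose tau := 11 / 10 / (M - 1).
  have tE : tau * (M - 1) = 11 / 10 by rewrite /tau divfK // gt_eqF //; lra.
  have t01 : 0 < tau <= 1 by rewrite divr_gt0 //= ?ler_pdivrMr; lra.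
  apply: (@excess_bound [set u] 1 tau (101 / 100)) => //.
  - by apply: lt_le_trans (key _ t01); rewrite tE kE; move: QF; rewrite FE2; lra.
  - move=> i iL; apply: (le_trans (nsum_excess_sum L1 t01 iL)).
    rewrite -/f -/F FE2; have : 56 * 56 <= M ^+ 2 by rewrite expr2 ler_pM ?ltW.
    by lra.
  move=> i; rewrite inE => /eqP->.
  by rewrite deg_in1 adj_irrefl mulr0 addr0 deg_out1 -/k kE; lra.
have kE : k = 2%N by move: kF k2 F2; clear; lia.
have FE : F = 2%N by move: kF k2 F2; clear; lia.
have /eqP/cards2P[v1 [v2 [v12 Ev]]] := kE.
have au x : adj u x = (x == v1) || (x == v2).
  by have := congr1 (fun A : {set G} => x \in A) Ev; rewrite !inE.
pose v b := if b then v2 else v1.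
have vi : injective v by move=> [] [] // /eqP; rewrite /v ?(negPf v12) // eq_sym (negPf v12).
have auv b : adj u (v b) by rewrite au; case: b; rewrite eqxx ?orbT.
have vu b : v b != u by apply: contraTneq (auv b) => ->; rewrite adj_irrefl.
have FE3 : F = (f v1 + (f v2 + \sum_(i | [&& i \notin [set u], i != v1 & i != v2]) f i))%N.
  rewrite /F (bigD1 v1) ?inu ?(vu false) //= (bigD1 v2) ?inu ?(vu true) ?(eq_sym v2) //=.
  by congr (_ + (_ + _))%N; apply: eq_bigl => j; rewrite -andbA.
have fv1 := f_pos _ (auv false); have fv2 := f_pos _ (auv true).
have dv b : ndeg [set u] (v b) = 2%N.
  by have [-> _] := fP _ (vu b); congr _.+1; move: FE FE3 fv1 fv2; case: b; clear; rewrite /=; lia.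
have d1 x : x != u -> ~~ adj u x -> ndeg [set u] x = 1%N.
  move=> xu; rewrite au negb_or => /andP[x1 x2]; have [-> _] := fP x xu; congr _.+1.
  by move: FE FE3 fv1 fv2; rewrite (bigD1 x) ?inu ?xu ?x1 //= /v; clear; lia.
have [Kvv|Kvv] := boolP (nadj [set u] (v false) (v true)).
  by apply: Or33; apply: (@nonadjacent_neighbours_bound u v).
by apply: Or32; apply: (@H2_shape _ u v).
Qed.

(** With two vertices removed, excess equals complement degree, so the set [P] of vertices of
    positive excess contains all complement neighbours. Connectivity puts a neighbour of [L] into
    [P], hence a second vertex too. Three vertices in [P] yield about [3 * M]; if there are only
    two, both have excess 1 and yield about [2 * (M - 1)]. *)
Lemma two_low_vertices (u u' : G) : u != u' ->
  (degree u <= 3)%N -> (degree u' <= 3)%N ->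
  forall a, eigenvalue (adjmx R G) a -> a < M - 1.
Proof.
move=> uu' du du'; have M56 := M_gt; have ds := delta_lt; have d0 := delta_gt0.
have dM2 := deltaM2.
pose L := [set u; u'].
have L0 : (#|L| + 0 = 2)%N by rewrite cards2 uu'.
have Lgt : (0 < #|L|)%N by rewrite cards2 uu'.
pose f := excess L.
have fP i : i \notin L -> [/\ ndeg L i = f i, (deg_in L i <= f i)%N &
    (f i)%:R <= M - 1 + delta].
  move=> iL; have [-> ? h _] := excessP L0 iL; split => //.
  by rewrite /f h; have := ler0n R (deg_out L i); lra.
have degL i : i \in L -> (degree i <= 3)%N by rewrite !inE => /orP[]/eqP->.
have dinL i : i \in L -> (deg_in L i <= 2)%N.
  move=> iL; apply: (@leq_trans #|L|); last by move: L0; lia.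
  by apply: subset_leq_card; apply/subsetP => j; rewrite inE => /andP[].
have doutL i : i \in L -> (deg_out L i <= 3)%N.
  by move=> /degL; rewrite -(deg_in_out L); lia.
pose P := [set i | (i \notin L) && (0 < f i)%N].
have nbP i j : nadj L i j -> j \in P.
  rewrite nadj_sym => ji; have [jL _] := nadj_out ji.
  have [e _ _] := fP j jL; rewrite inE jL -e card_gt0 /=.
  by apply/set0Pn; exists i; rewrite inE.
have fltP i : i \notin L -> (0 < f i)%N -> (f i < #|P|)%N.
  move=> iL fi; have [<- _ _] := fP i iL; rewrite [#|P|](cardsD1 i) inE iL fi ltnS.
  apply: subset_leq_card; apply/subsetP => j; rewrite in_set => ij.
  rewrite in_setD1 (nbP _ _ ij) andbT.
  by apply: contraTneq ij => ->; rewrite nadj_irrefl.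
have m2 : (1 < #|P|)%N.
  have [y yL] : exists y, y \notin L.
    have : (0 < #|~: L|)%N by move: (cardsC L) L0 cardG_gt; lia.
    by case/card_gt0P => y; rewrite inE => yL; exists y.
  have uL : u \in L by rewrite !inE eqxx.
  have [a [b [aL bL ab]]] := cut_edge connG uL yL.
  have [_ db _] := fP b bL.
  have fb : (0 < f b)%N.
    by apply: leq_trans db; apply/card_gt0P; exists a; rewrite inE aL adj_sym.
  exact: leq_trans (fltP b bL fb).
have term tau i : 0 < tau <= 1 -> i \notin L ->
    (1 - tau) * (f i)%:R * (M - (f i)%:R) <=
    ((f i)%:R - tau * (deg_in L i)%:R) * (M - 0%:R - (f i)%:R).
  move=> /andP[t0 t1] iL; have [_ + fM] := fP i iL.
  rewrite -(ler_nat R) => df; rewrite subr0 ler_wpM2r //; first by lra.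
  by have : tau * (deg_in L i)%:R <= tau * (f i)%:R by [rewrite ler_pM2l]; lra.
have sumP tau c : 0 < tau <= 1 ->
    (forall i, i \in P -> c <= (f i)%:R * (M - (f i)%:R)) ->
    (1 - tau) * (#|P|%:R * c) <= \sum_(i | i \notin L)
      ((f i)%:R - tau * (deg_in L i)%:R) * (M - 0%:R - (f i)%:R).
  move=> t01 Hc; have /andP[t0 t1] := t01.
  rewrite (bigID (mem P)) /= -[leLHS]addr0; apply: lerD; last first.
    apply: sumr_ge0 => i /andP[iL iP].
    have fi : f i = 0%N by move: iP; rewrite inE iL /= -eqn0Ngt => /eqP.
    by apply: le_trans (term _ _ t01 iL); rewrite fi mulr0 mul0r.
  rewrite mulr_natl -sumr_const mulr_sumr.
  rewrite [leRHS](eq_bigl (fun i => i \in P)) => [|i]; last first.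
    by rewrite [i \in P]in_set andbA andbb.
  apply: ler_sum => i iP; apply: le_trans (term _ _ t01 _); last first.
    by move: iP; rewrite inE => /andP[].
  by rewrite -mulrA ler_wpM2l ?Hc //; lra.
have M3 : M - 3 != 0 by rewrite gt_eqF //; lra.
have [m3|m3] := leqP 3 #|P|.
  (* This makes [(M - 1) * tau] equal to [7 + 2 * tau], above the [2 * 3 + 2 * tau] that a vertex of
     [L] can require. *)
  pose tau := 7 / (M - 3).
  have tE : tau * (M - 3) = 7 by rewrite /tau divfK.
  have t01 : 0 < tau <= 1 by rewrite divr_gt0 //= ?ler_pdivrMr; lra.
  have /andP[t0 t1] := t01.
  apply: (@excess_bound L 0 tau 2) => //.
  - apply: lt_le_trans (sumP tau (M - 3) t01 _) => [|i].
      have m3' : 3 <= #|P|%:R :> R by rewrite (ler_nat R 3).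
      apply: (@lt_le_trans _ _ ((1 - tau) * (3 * (M - 3)))); first by lra.
      by rewrite ler_wpM2l ?ler_wpM2r //; lra.
    rewrite inE => /andP[iL fi]; have [_ _ fM] := fP i iL.
    have fi1 : 1 <= (f i)%:R :> R by rewrite ler1n.
    (* Concavity of [f * (M - f)] between 1 and [M - 1 + delta]: it is at least [M - 1] up to an
       error [M * delta < 2]. *)
    have h1 : 0 <= ((f i)%:R - 1) * (M - 1 + delta - (f i)%:R) by rewrite mulr_ge0 //; lra.
    have h2 : ((f i)%:R - 1) * delta <= M * delta by rewrite ler_wpM2r //; lra.
    by move: deltaM; lra.
  - by move=> i iL; apply: (@nsum_excess_crude _ 0).
  move=> i iL; have := dinL i iL; have := doutL i iL.
  rewrite -(ler_nat R _ 3) -(ler_nat R _ 2) => h1 h2.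
  have : tau * (deg_in L i)%:R <= tau * 2 by rewrite ler_pM2l.
  by lra.
have mE : #|P| = 2%N by apply/eqP; rewrite eqn_leq m2 -ltnS m3.
have f1 i : i \in P -> f i = 1%N.
  by rewrite inE => /andP[iL fi]; have := fltP i iL fi; rewrite mE; move: fi; clear; lia.
have F2 : (\sum_(i | i \notin L) f i = 2)%N.
  rewrite -mE -sum1_card [LHS](bigID (mem P)) /= [X in (_ + X)%N]big1 => [|i /andP[iL iP]].
    rewrite addn0 (eq_bigl (fun i => i \in P)) => [|i]; last by rewrite [i \in P]in_set andbA andbb.
    exact: eq_bigr.
  by move: iP; rewrite inE iL /= -eqn0Ngt => /eqP.
have doutL2 i : i \in L -> (deg_out L i <= 2)%N.
  move=> iL; rewrite -mE; apply: subset_leq_card; apply/subsetP => j.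
  rewrite inE => /andP[jL ij]; have [_ + _] := fP j jL.
  rewrite inE jL /=.
  by apply: leq_trans; apply/card_gt0P; exists i; rewrite inE iL adj_sym.
(* Outer neighbours of [L] lie in [P], so a vertex of [L] requires at most
   [2 * (101 / 100) + 2 * tau], below [(M - 1) * tau = 21 / 10 + 2 * tau]. *)
pose tau := 21 / 10 / (M - 3).
have tE : tau * (M - 3) = 21 / 10 by rewrite /tau divfK.
have t01 : 0 < tau <= 1 by rewrite divr_gt0 //= ?ler_pdivrMr; lra.
have /andP[t0 t1] := t01.
have ts : tau <= 1 / 20 by rewrite ler_pdivrMr; lra.
apply: (@excess_bound L 0 tau (101 / 100)) => //.
- apply: lt_le_trans (sumP tau (M - 1) t01 _) => [|i /f1->]; last by lra.
  by rewrite mE; lra.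
- move=> i iL; apply: (le_trans (nsum_excess_sum L0 t01 iL)).
  rewrite F2; have : 56 * 56 <= M ^+ 2 by rewrite expr2 ler_pM ?ltW.
  by lra.
move=> i iL; have := dinL i iL; have := doutL2 i iL.
rewrite -!(ler_nat R _ 2) => h1 h2.
have : tau * (deg_in L i)%:R <= tau * 2 by rewrite ler_pM2l.
by lra.
Qed.

Lemma nonregular_cases : ~ regular G ->
  [\/ ~~ odd #|G| /\ giso G (H1 #|G|), odd #|G| /\ giso G (H2 #|G|) |
      forall a, eigenvalue (adjmx R G) a -> a < M - 1].
Proof.
move=> nreg; have [/existsP[u du]|/existsPn d4] := boolP [exists x : G, (degree x <= 3)%N].
  have [/existsP[u' /andP[uu' du']]|/existsPn d4] :=
    boolP [exists x : G, (x != u) && (degree x <= 3)%N].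
    by apply: Or33; apply: (two_low_vertices uu').
  apply: (one_low_vertex du) => x xu.
  by have := d4 x; rewrite xu -ltnNge.
apply: Or33; apply: min_degree4_bound => // x.
by have := d4 x; rewrite -ltnNge.
Qed.

End Cases.

(** * Invariance under isomorphism *)

Section Transfer.
Variables (G H : sgraph) (f : G -> H).
Hypotheses (f_bij : bijective f) (f_adj : forall x y, adj (f x) (f y) = adj x y).

Lemma degree_giso x : degree (f x) = degree x.
Proof.
rewrite !degree_sum (reindex f) /=; last exact: onW_bij.
by apply: eq_bigl => y; rewrite f_adj.
Qed.

Lemma connect_giso x y : connect (@adj G) x y -> connect (@adj H) (f x) (f y).
Proof.
case/connectP=> p; elim: p x => [|z p IH] x /= => [_ ->|/andP[xz pz] yE].
  exact: connect0.
by apply: connect_trans (IH z pz yE); apply: connect1; rewrite f_adj.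
Qed.

End Transfer.

Lemma giso_nonregular_class n d (G H : sgraph) : giso G H ->
  nonregular_class n d H -> nonregular_class n d G.
Proof.
move=> [f fb fa] [cH [H0 cnH] nr md]; have cE := bij_eq_card fb.
have dE := degree_giso fb fa; split; first by rewrite cE.
- split; first by rewrite cE.
  have [g gf fg] := fb; move=> x y; rewrite -(gf x) -(gf y).
  apply: connect_giso => [u v|]; last exact: cnH.
  by rewrite -fa !fg.
- have [g gf fg] := fb.
  by move=> r; apply: nr => x y; rewrite -(fg x) -(fg y) !dE.
rewrite -md /max_degree [RHS](reindex f) /=; last exact: onW_bij.
by apply: eq_bigr => x _; rewrite dE.
Qed.

(** * Extremality, and existence of the defect [delta] *)

Section Extremal.
Variable R : realType.

Lemma giso_eigenvalue (G H : sgraph) (a : R) : giso G H ->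
  eigenvalue (adjmx R G) a -> eigenvalue (adjmx R H) a.
Proof.
move=> [f fb fa] /eigenvalue_adjmxP[x [i xi] xA]; have [g gf fg] := fb.
apply/eigenvalue_adjmxP; exists (x \o g); first by exists (f i); rewrite /= gf.
move=> j; rewrite /= -xA (reindex f) /=; last exact: onW_bij.
by rewrite -{1}(fg j); apply: eq_big => [y|y _]; rewrite ?fa ?gf.
Qed.

(** The strict bound for non-isomorphic members gives both maximality of [H] and uniqueness, since
    an extremal graph must have an eigenvalue at least [r]. *)
Lemma extremal_iff_giso n d (H : sgraph) (r : R) :
  nonregular_class n d H -> is_spectral_radius H r ->
  (forall G, nonregular_class n d G ->
     giso G H \/ forall a, eigenvalue (adjmx R G) a -> a < r) ->
  forall G, extremal R n d G <-> giso G H.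
Proof.
move=> cH [rH rmax] all G; split=> [[cG [rho [rhoG _] rho_max]]|iso].
  have [//|lt_r] := all G cG.
  by have := lt_r _ rhoG; rewrite ltNge (rho_max H r cH).
split; first exact: giso_nonregular_class iso cH.
exists r; first split.
- exact: giso_eigenvalue (giso_sym iso) rH.
- by move=> a /(giso_eigenvalue iso)/rmax.
move=> H' rho' cH' [rhoH' _]; have [iso'|lt_r] := all H' cH'.
  exact: rmax (giso_eigenvalue iso' rhoH').
exact: ltW (lt_r _ rhoH').
Qed.

(** An inequality on [delta] serves both parities: it is an equality for the defect of [H2] and
    follows from the equation for that of [H1]. *)
Lemma nonregular_class_cases n (G : sgraph) (M delta : R) :
  nonregular_class n (n - 3) G -> 56 < M -> n%:R = M + 2 + delta -> 0 < delta ->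
  delta * (M ^+ 3 - M ^+ 2 - 4 * M + 2) <= 2 * (M - 3) * (M - 2) ->
  [\/ ~~ odd n /\ giso G (H1 n), odd n /\ giso G (H2 n) |
      forall a, eigenvalue (adjmx R G) a -> a < M - 1].
Proof.
move=> [<- cG nr md] M56 nM d0 dM.
have dM2 := delta_M2 M56 dM; have dM1 := delta_M M56 dM2.
apply: (@nonregular_cases R G M delta) => //; first exact: delta_small dM1.
by move=> x; rewrite -md; apply: (leq_bigmax x).
Qed.

(** The polynomial [N - (c - X) D] takes the value [N - D / 2] at [c - 1/2] and [N] at [c], so the
    hypotheses force a sign change. *)
Lemma ivt_defect (c : R) (D N : {poly R}) : 0 <= N.[c] ->
  2 * N.[c - 2^-1] <= D.[c - 2^-1] ->
  exists M, c - 2^-1 <= M <= c /\ (c - M) * D.[M] = N.[M].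
Proof.
move=> Nc Nc2; have [||M Mc /rootP] := @poly_ivt R (N - (c%:P - 'X) * D) (c - 2^-1) c.
- by lra.
- by rewrite !hornerE; apply/andP; split; lra.
by rewrite !hornerE => E; exists M; split; [exact: Mc | lra].
Qed.

Lemma H1_defect n : (59 <= n)%N -> exists M delta : R,
  [/\ 56 < M, n%:R = M + 2 + delta, 0 < delta &
      delta * (M ^+ 3 - M ^+ 2 - 3 * M + 2) = (M - 2) ^+ 2].
Proof.
rewrite -(ler_nat R) => n59; pose c : R := n%:R - 2.
pose D : {poly R} := 'X^3 - 'X^2 - 3%:P * 'X + 2%:P.
pose N : {poly R} := ('X - 2%:P) ^+ 2.
have DE x : D.[x] = x ^+ 3 - x ^+ 2 - 3 * x + 2 by rewrite /D !hornerE; ring.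
have NE x : N.[x] = (x - 2) ^+ 2 by rewrite /N !hornerE; ring.
have [||M [/andP[cM Mc]]] := @ivt_defect c D N; rewrite ?DE ?NE.
- exact: sqr_ge0.
- have : 56 <= c - 2^-1 by rewrite /c; lra.
  move: (c - 2^-1) => x x56; rewrite -subr_ge0.
  have -> : x ^+ 3 - x ^+ 2 - 3 * x + 2 - 2 * (x - 2) ^+ 2 =
    (x - 3) * x ^+ 2 + (5 * x - 6) by ring.
  by rewrite addr_ge0 ?mulr_ge0 ?sqr_ge0 //; lra.
(* From [n >= 59], the left end [n - 5/2] of the interval is at least [113 / 2]. *)
move=> E; have M56 : 56 < M by move: cM; rewrite /c; lra.
exists M, (c - M); split => //; first by rewrite /c; ring.
rewrite lt_neqAle subr_ge0 Mc andbT; apply/eqP => d0.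
by move: E; rewrite -d0 mul0r => /esym/eqP; rewrite sqrf_eq0 => /eqP; lra.
Qed.

Lemma H2_defect n : (59 <= n)%N -> exists M delta : R,
  [/\ 56 < M, n%:R = M + 2 + delta, 0 < delta &
      delta * (M ^+ 3 - M ^+ 2 - 4 * M + 2) = 2 * (M - 3) * (M - 2)].
Proof.
rewrite -(ler_nat R) => n59; pose c : R := n%:R - 2.
pose D : {poly R} := 'X^3 - 'X^2 - 4%:P * 'X + 2%:P.
pose N : {poly R} := 2%:P * ('X - 3%:P) * ('X - 2%:P).
have DE x : D.[x] = x ^+ 3 - x ^+ 2 - 4 * x + 2 by rewrite /D !hornerE; ring.
have NE x : N.[x] = 2 * (x - 3) * (x - 2) by rewrite /N !hornerE; ring.
have [||M [/andP[cM Mc]]] := @ivt_defect c D N; rewrite ?DE ?NE.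
- by rewrite !mulr_ge0 // /c; lra.
- have : 56 <= c - 2^-1 by rewrite /c; lra.
  move: (c - 2^-1) => x x56; rewrite -subr_ge0.
  have -> : x ^+ 3 - x ^+ 2 - 4 * x + 2 - 2 * (2 * (x - 3) * (x - 2)) =
    (x - 5) * x ^+ 2 + (16 * x - 22) by ring.
  by rewrite addr_ge0 ?mulr_ge0 ?sqr_ge0 //; lra.
move=> E; have M56 : 56 < M by move: cM; rewrite /c; lra.
exists M, (c - M); split => //; first by rewrite /c; ring.
rewrite lt_neqAle subr_ge0 Mc andbT; apply/eqP => d0.
have : 0 < 2 * (M - 3) * (M - 2) by rewrite !mulr_gt0 //; lra.
by rewrite -E -d0 mul0r ltxx.
Qed.

End Extremal.

Theorem theorem1p2 (R : realType) (n : nat) (G : sgraph) (hn : (59 <= n)%N) :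
  (~~ odd n -> (extremal R n (n - 3) G <-> giso G (H1 n))) /\
  (odd n -> (extremal R n (n - 3) G <-> giso G (H2 n))).
Proof.
split=> on.
- have [M [delta [M56 nM d0 dM]]] := H1_defect R hn.
  apply: (@extremal_iff_giso R n _ (H1 n) (M - 1)).
  + by apply: nonregular_class_H1 => //; lia.
  + by apply: (spectral_radius_H1 _ _ _ nM dM) => //; [lia | lra].
  move=> G' cG'; have [|[_ iso]|[on' _]|lt_r] := nonregular_class_cases cG' M56 nM d0.
  (* The two cubics differ by [M], and [2 * (M - 3) * (M - 2)] exceeds [(M - 2) ^+ 2] by
     [(M - 4) * (M - 2)]. *)
  + have h1 : delta * (M ^+ 3 - M ^+ 2 - 4 * M + 2) =
        (M - 2) ^+ 2 - delta * M by rewrite -dM; ring.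
    have h2 : 0 < delta * M by rewrite mulr_gt0 //; lra.
    have h3 : 0 <= (M - 4) * (M - 2) by rewrite mulr_ge0 //; lra.
    by rewrite h1 expr2; lra.
  + by left.
  + by rewrite on' in on.
  by right.
- have [M [delta [M56 nM d0 dM]]] := H2_defect R hn.
  apply: (@extremal_iff_giso R n _ (H2 n) (M - 1)).
  + by apply: nonregular_class_H2 => //; lia.
  + by apply: (spectral_radius_H2 _ _ _ nM dM) => //; [lia | lra].
  move=> G' cG'; have [|[on' _]|[_ iso]|lt_r] := nonregular_class_cases cG' M56 nM d0.
  + by rewrite dM.
  + by rewrite on in on'.
  + by left.
  by right.
Qed.
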